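(* Let $n\ge1$, $I\subseteq\{1,\dots,n\}$, $m=2n-1-|I|$, and let $f=\sum_{i=1}^{m-1}\mathsf x_i'\mathsf x_{i+1}+\sum_{i=1}^m\sum_{j=2}^\infty\kappa'_{ij}\mathsf x_i^j$ with all $\kappa'_{ij}\in\mathbb C$ be a monomialized Type $A$ potential on $Q_{n,I}$. Then there exists a monomialized Type $A$ potential $$g=\sum_{i=1}^{2n-2}\mathsf x_i'\mathsf x_{i+1}+\sum_{i=1}^{2n-1}\sum_{j=2}^\infty\kappa_{ij}\mathsf x_i^j$$ on $Q_n$, for some $\kappa_{ij}\in\mathbb C$, such that $\operatorname{Jac}(Q_n,g)\cong\operatorname{Jac}(Q_{n,I},f)$ and $\kappa_{2i-1,2}\neq0$ for each $i\in I$.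
   Context: Everything is over $\mathbb C$. For a finite quiver with tail and head maps $t,h$, a path is a product $c_1c_2\cdots c_r$ of arrows with $h(c_i)=t(c_{i+1})$. $\mathbb C\langle\langle Q\rangle\rangle$ is the completion of the path algebra at the ideal generated by the arrows. A potential $W$ on $Q$ is a (possibly infinite) $\mathbb C$-linear combination of cyclic paths. The cyclic derivative by an arrow $a$ is $\partial_a(c_1\cdots c_d)=\sum_{i}\delta_{a,c_i}c_{i+1}\cdots c_dc_1\cdots c_{i-1}$, extended linearly and continuously. The Jacobi algebra $\operatorname{Jac}(Q,W)$ is $\mathbb C\langle\langle Q\rangle\rangle$ modulo the closure of the two-sided ideal generated by all $\partial_aW$. For $I\subseteq\{1,\dots,n\}$, $Q_{n,I}$ has vertices $1,\dots,n$, one arrow $i\to i+1$ and one arrow $i+1\to i$ for each $1\le i\le n-1$, and one loop at each vertex $i\notin I$. Put $m=2n-1-|I|$. List from left to right: the loop at $1$ (if $1\notin I$), the pair of arrows between $1,2$, the loop at $2$ (if $2\notin I$), the pair between $2,3$, and so on; this list has $m$ members. If the $k$-th member is a loop, call it $a_k$ and let $b_k$ be the trivial path at its vertex; if it is the pair between $i,i+1$, let $a_k\colon i\to i+1$ and $b_k\colon i+1\to i$. Set $\mathsf x_k=a_kb_k$ and $\mathsf x_k'=b_ka_k$ for $1\le k\le m$. Write $Q_n=Q_{n,\emptyset}$; in $Q_n$ the element $\mathsf x_{2i-1}$ is the loop at vertex $i$. *)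

(* Defs.v *)
From HB Require Import structures.
From mathcomp Require Import all_boot all_order all_algebra generic_quotient.
From mathcomp Require Import ring_quotient complex.
From mathcomp Require Import zify.
From mathcomp Require Import boolp classical_sets reals.

Set Implicit Arguments.
Unset Strict Implicit.
Unset Printing Implicit Defensive.

Import GRing.Theory.
Local Open Scope ring_scope.
Local Open Scope quotient_scope.

Record quiver := Quiver {
  vertex : finType;
  arrow : finType;
  tail : arrow -> vertex;
  head : arrow -> vertex
}.

Section Paths.
Variable Q : quiver.

Definition composable : rel (arrow Q) := fun c d => tail d == head c.

(* A path is encoded by its starting vertex v and the list s of its arrows,
   composed from left to right; (v, [::]) is the trivial path at v. *)
Definition is_path (v : vertex Q) (s : seq (arrow Q)) : bool :=
  if s is c :: s' then (tail c == v) && path composable c s' else true.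

Definition path_end (v : vertex Q) (s : seq (arrow Q)) : vertex Q :=
  last v (map (@head Q) s).

Lemma path_is_path c s : path composable c s = is_path (head c) s.
Proof. by case: s. Qed.

Lemma is_path_cons v c s :
  is_path v (c :: s) = (tail c == v) && is_path (head c) s.
Proof. by rewrite /= path_is_path. Qed.

Lemma is_path_cat v s t :
  is_path v (s ++ t) = is_path v s && is_path (path_end v s) t.
Proof.
elim: s v => [|c s IH] v //.
by rewrite cat_cons !is_path_cons IH andbA.
Qed.

End Paths.

(* The completed path algebra of Q over K: formal, possibly infinite, linear
   combinations of paths, that is, families of coefficients indexed by the
   paths of Q; the coefficients at lists that are not paths are set to 0. *)
Record pathser (K : fieldType) (Q : quiver) := PathSer {
  coef :> vertex Q -> seq (arrow Q) -> K;
  coef_supp : forall v s, ~~ is_path v s -> coef v s = 0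
}.

HB.instance Definition _ K Q := gen_eqMixin (pathser K Q).
HB.instance Definition _ K Q := gen_choiceMixin (pathser K Q).

Section CompletedPathAlgebra.
Variables (K : fieldType) (Q : quiver).
Implicit Types x y z : pathser K Q.

Lemma pathserP x y : (forall v s, x v s = y v s) -> x = y.
Proof.
case: x y => [f Hf] [g Hg] /= E.
have Efg : f = g by apply/funext => v; apply/funext => s; exact: E.
by case: _ / Efg Hg => Hg; congr PathSer; exact: Prop_irrelevance.
Qed.

Fact ser_zero_supp v (s : seq (arrow Q)) : ~~ is_path v s -> 0 = 0 :> K.
Proof. by []. Qed.
Definition ser_zero := PathSer ser_zero_supp.

Fact ser_opp_supp x v s : ~~ is_path v s -> - x v s = 0.
Proof. by move=> h; rewrite coef_supp ?oppr0. Qed.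
Definition ser_opp x := PathSer (ser_opp_supp x).

Fact ser_add_supp x y v s : ~~ is_path v s -> x v s + y v s = 0.
Proof. by move=> h; rewrite !coef_supp ?addr0. Qed.
Definition ser_add x y := PathSer (ser_add_supp x y).

Fact ser_addA : associative ser_add.
Proof. by move=> x y z; apply: pathserP => v s; apply: addrA. Qed.
Fact ser_addC : commutative ser_add.
Proof. by move=> x y; apply: pathserP => v s; apply: addrC. Qed.
Fact ser_add0 : left_id ser_zero ser_add.
Proof. by move=> x; apply: pathserP => v s; apply: add0r. Qed.
Fact ser_addN : left_inverse ser_zero ser_opp ser_add.
Proof. by move=> x; apply: pathserP => v s; apply: addNr. Qed.
HB.instance Definition _ := GRing.isZmodule.Build (pathser K Q)
  ser_addA ser_addC ser_add0 ser_addN.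

Lemma coef0 v s : (0 : pathser K Q) v s = 0. Proof. by []. Qed.
Lemma coefN x v s : (- x) v s = - x v s. Proof. by []. Qed.
Lemma coefD x y v s : (x + y) v s = x v s + y v s. Proof. by []. Qed.
Lemma coefB x y v s : (x - y) v s = x v s - y v s. Proof. by []. Qed.
Lemma coef_sum (J : Type) (r : seq J) (P : pred J) (F : J -> pathser K Q) v s :
  (\sum_(j <- r | P j) F j) v s = \sum_(j <- r | P j) F j v s.
Proof. exact: (big_morph (fun x => coef x v s) (fun x y => coefD x y v s)). Qed.

Fact ser_scale_supp (a : K) x v s : ~~ is_path v s -> a * x v s = 0.
Proof. by move=> h; rewrite coef_supp ?mulr0. Qed.
Definition ser_scale a x := PathSer (ser_scale_supp a x).

Fact ser_scaleA a b x : ser_scale a (ser_scale b x) = ser_scale (a * b) x.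
Proof. by apply: pathserP => v s; apply: mulrA. Qed.
Fact ser_scale1 : left_id 1 ser_scale.
Proof. by move=> x; apply: pathserP => v s; apply: mul1r. Qed.
Fact ser_scaleDr : right_distributive ser_scale +%R.
Proof. by move=> a x y; apply: pathserP => v s; apply: mulrDr. Qed.
Fact ser_scaleDl x : {morph ser_scale^~ x : a b / a + b}.
Proof. by move=> a b; apply: pathserP => v s; apply: mulrDl. Qed.
HB.instance Definition _ := GRing.Zmodule_isLmodule.Build K (pathser K Q)
  ser_scaleA ser_scale1 ser_scaleDr ser_scaleDl.

Lemma coefZ a x v s : (a *: x) v s = a * x v s. Proof. by []. Qed.

(* Multiplication is concatenation of paths: the coefficient of x * y at a path
   sums over all ways to cut this path in two. *)
Definition conv (f : seq (arrow Q) -> K) (g : vertex Q -> seq (arrow Q) -> K)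
    (v : vertex Q) (s : seq (arrow Q)) : K :=
  \sum_(k < (size s).+1) f (take k s) * g (path_end v (take k s)) (drop k s).

Lemma conv_nil f g v : conv f g v [::] = f [::] * g v [::].
Proof. by rewrite /conv big_ord_recl big_ord0 addr0. Qed.

Lemma conv_cons f g v c s :
  conv f g v (c :: s) =
  f [::] * g v (c :: s) + conv (fun t => f (c :: t)) g (head c) s.
Proof. by rewrite /conv big_ord_recl. Qed.

Lemma convDl f f' g v s :
  conv (fun t => f t + f' t) g v s = conv f g v s + conv f' g v s.
Proof. by rewrite -big_split; apply: eq_bigr => k _; rewrite mulrDl. Qed.

Lemma convZl a f g v s : conv (fun t => a * f t) g v s = a * conv f g v s.
Proof. by rewrite mulr_sumr; apply: eq_bigr => k _; rewrite mulrA. Qed.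

Lemma convA f g h v s :
  conv (conv f g v) h v s = conv f (fun w => conv (g w) h w) v s.
Proof.
elim: s f v => [|c s IH] f v; first by rewrite !conv_nil mulrA.
rewrite !conv_cons conv_nil -IH mulrDr -addrA mulrA; congr (_ + _).
rewrite -convZl -convDl; congr (conv _ h _ s).
by apply/funext => t; rewrite conv_cons.
Qed.

Fact ser_mul_supp x y v s : ~~ is_path v s -> conv (x v) y v s = 0.
Proof.
move=> h; apply: big1 => k _.
move: h; rewrite -{1}(cat_take_drop k s) is_path_cat negb_and.
by case/orP => h; [rewrite (coef_supp x h) mul0r | rewrite (coef_supp y h) mulr0].
Qed.
Definition ser_mul x y := PathSer (ser_mul_supp x y).

Fact ser_one_supp (v : vertex Q) (s : seq (arrow Q)) :
  ~~ is_path v s -> (s == [::])%:R = 0 :> K.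
Proof. by case: s. Qed.
Definition ser_one := PathSer ser_one_supp.

Fact ser_mulA : associative ser_mul.
Proof. by move=> x y z; apply: pathserP => v s; rewrite /= convA. Qed.
Fact ser_mul1 : left_id ser_one ser_mul.
Proof.
move=> x; apply: pathserP => v s; rewrite /= /conv big_ord_recl /= take0 drop0.
rewrite mul1r big1 ?addr0 // => k _.
by case: s k => [[]|c s k] //; rewrite /= mul0r.
Qed.
Fact ser_mulr1 : right_id ser_one ser_mul.
Proof.
move=> x; apply: pathserP => v s; rewrite /= /conv big_ord_recr /=.
rewrite take_size drop_size mulr1 big1 ?add0r // => k _.
rewrite -size_eq0 size_drop subn_eq0 leqNgt ltn_ord /=; exact: mulr0.
Qed.
Fact ser_mulDl : left_distributive ser_mul +%R.
Proof. by move=> x y z; apply: pathserP => v s; apply: convDl. Qed.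
Fact ser_mulDr : right_distributive ser_mul +%R.
Proof.
move=> x y z; apply: pathserP => v s; rewrite coefD /= -big_split.
by apply: eq_bigr => k _; rewrite /= mulrDr.
Qed.
HB.instance Definition _ := GRing.Zmodule_isPzRing.Build (pathser K Q)
  ser_mulA ser_mul1 ser_mulr1 ser_mulDl ser_mulDr.

Lemma coefM x y v s :
  (x * y) v s =
  \sum_(k < (size s).+1) x v (take k s) * y (path_end v (take k s)) (drop k s).
Proof. by []. Qed.
Lemma coef1 v s : (1 : pathser K Q) v s = (s == [::])%:R. Proof. by []. Qed.

Lemma ser_scalerAl (a : K) x y : a *: (x * y) = (a *: x) * y.
Proof.
by apply: pathserP => v s; rewrite coefZ !coefM mulr_sumr;
   apply: eq_bigr => k _; rewrite mulrA.
Qed.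
Lemma ser_scalerAr (a : K) x y : a *: (x * y) = x * (a *: y).
Proof.
by apply: pathserP => v s; rewrite coefZ !coefM mulr_sumr;
   apply: eq_bigr => k _; rewrite coefZ mulrCA.
Qed.

Fact ser_path_supp (u : vertex Q) (t : seq (arrow Q)) v s :
  ~~ is_path v s -> [&& is_path u t, v == u & s == t]%:R = 0 :> K.
Proof.
by move=> h; case: and3P => // -[ut /eqP vu /eqP st]; rewrite vu st ut in h.
Qed.
Definition ser_path u t := PathSer (ser_path_supp u t).

Definition ser_triv (u : vertex Q) := ser_path u [::].
Definition ser_arrow (c : arrow Q) := ser_path (tail c) [:: c].

Lemma ser_arrow_triv c : ser_arrow c * ser_triv (head c) = ser_arrow c.
Proof.
apply: pathserP => v [|d s]; first by rewrite [LHS]conv_nil /= !andbF mul0r.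
rewrite [LHS]conv_cons /= !andbF mul0r add0r /conv big_ord_recl take0 drop0 /=.
rewrite [X in _ + X]big1 ?addr0 => [|k _].
  rewrite !andbT eqxx /= !eqseq_cons andbT.
  rewrite -natrM mulnb /path_end /=; congr (nat_of_bool _)%:R.
  by case: (v == _); case: eqVneq => //= ->; rewrite eqxx.
by case: s k => [[]|e s k] //=; rewrite !eqseq_cons !andbF mul0r.
Qed.

(* Congruence modulo the N-th power of the ideal generated by the arrows: in the
   completion this power consists of the combinations of paths of length at
   least N. *)
Definition agree (N : nat) x y : Prop :=
  forall v s, (size s < N)%N -> x v s = y v s.

Definition adic_closure (S : set (pathser K Q)) : set (pathser K Q) :=
  [set x | forall N, exists2 y, S y & agree N x y]%classic.

Definition adic_limit (u : nat -> pathser K Q) (l : pathser K Q) : Prop :=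
  forall N, exists M, forall k, (M <= k)%N -> agree N (u k) l.

Definition ideal_gen (S : set (pathser K Q)) : set (pathser K Q) :=
  [set x | exists2 r : seq (pathser K Q * pathser K Q * pathser K Q),
     (forall t, t \in r -> S t.1.2) &
     x = \sum_(t <- r) t.1.1 * t.1.2 * t.2]%classic.

Definition is_potential (W : pathser K Q) : Prop :=
  forall v s, W v s != 0 -> s != [::] /\ path_end v s = v.

(* The coefficient of the cyclic derivative of W by a at the path s: every
   cyclic path c_1...c_d of W contributes its coefficient once for each i with
   c_i = a and c_{i+1}...c_d c_1...c_{i-1} = s. With 0-based indices the two
   conditions read rot i c = a :: s. *)
Definition cycder_coef (a : arrow Q) (W : pathser K Q)
    (v : vertex Q) (s : seq (arrow Q)) : K :=
  if v == head a then
    \sum_(c : (size s).+1.-tuple (arrow Q) | cycle (@composable Q) c)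
      \sum_(i < (size s).+1 | rot i c == a :: s) W (tail (thead c)) c
  else 0.

Fact cycder_supp a W v s : ~~ is_path v s -> cycder_coef a W v s = 0.
Proof.
rewrite /cycder_coef; case: eqP => // -> h.
apply: big1 => c cyc_c; apply: big1 => i /eqP E; case/negP: h.
move: cyc_c; rewrite -(rot_cycle i) E /= rcons_path => /andP[+ _].
by rewrite path_is_path.
Qed.
Definition cycder a W := PathSer (@cycder_supp a W).

Definition jac_ideal_set (W : pathser K Q) : set (pathser K Q) :=
  adic_closure (ideal_gen [set cycder a W | a in setT]%classic).

Definition jac_ideal (W : pathser K Q) (x : pathser K Q) : bool :=
  `[< jac_ideal_set W x >].

Lemma agreeD N x y x' y' :
  agree N x y -> agree N x' y' -> agree N (x + x') (y + y').
Proof. by move=> h h' v s sN; rewrite !coefD h ?h'. Qed.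
Lemma agreeN N x y : agree N x y -> agree N (- x) (- y).
Proof. by move=> h v s sN; rewrite !coefN h. Qed.
Lemma agreeMl N z x y : agree N x y -> agree N (z * x) (z * y).
Proof.
move=> h v s sN; rewrite !coefM; apply: eq_bigr => k _; rewrite h //.
by rewrite size_drop (leq_ltn_trans (leq_subr _ _)).
Qed.
Lemma agreeMr N z x y : agree N x y -> agree N (x * z) (y * z).
Proof.
move=> h v s sN; rewrite !coefM; apply: eq_bigr => k _; rewrite h //.
by rewrite size_take_min (leq_ltn_trans (geq_minr _ _)).
Qed.

Section IdealGen.
Variable S : set (pathser K Q).

Lemma ideal_gen0 : ideal_gen S 0.
Proof. by exists [::] => //; rewrite big_nil. Qed.
Lemma ideal_genD x y : ideal_gen S x -> ideal_gen S y -> ideal_gen S (x + y).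
Proof.
case=> r hr -> [r' hr' ->]; exists (r ++ r'); last by rewrite big_cat.
by move=> t; rewrite mem_cat => /orP[/hr|/hr'].
Qed.
Lemma ideal_genMl z x : ideal_gen S x -> ideal_gen S (z * x).
Proof.
case=> r hr ->; exists [seq (z * t.1.1, t.1.2, t.2) | t <- r].
  by move=> _ /mapP[t /hr ? ->].
by rewrite big_map mulr_sumr; apply: eq_bigr => t _; rewrite /= !mulrA.
Qed.
Lemma ideal_genMr z x : ideal_gen S x -> ideal_gen S (x * z).
Proof.
case=> r hr ->; exists [seq (t.1.1, t.1.2, t.2 * z) | t <- r].
  by move=> _ /mapP[t /hr ? ->].
by rewrite big_map mulr_suml; apply: eq_bigr => t _; rewrite /= !mulrA.
Qed.
Lemma ideal_genN x : ideal_gen S x -> ideal_gen S (- x).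
Proof. by move=> h; rewrite -mulN1r; exact: ideal_genMl. Qed.
Lemma ideal_gen_mem x : S x -> ideal_gen S x.
Proof.
move=> Sx; exists [:: (1, x, 1)]; last by rewrite big_seq1 mul1r mulr1.
by move=> t; rewrite inE => /eqP->.
Qed.

End IdealGen.

Section JacIdeal.
Variable W : pathser K Q.

Lemma jac_idealP x : reflect (jac_ideal_set W x) (x \in jac_ideal W).
Proof. exact: asboolP. Qed.

Lemma jac_ideal_zmod_closed : zmod_closed (jac_ideal W).
Proof.
split=> [|x y /jac_idealP hx /jac_idealP hy]; apply/jac_idealP => N.
  by exists 0 => //; exact: ideal_gen0.
have [x' ? ?] := hx N; have [y' ? ?] := hy N; exists (x' - y').
  by apply: ideal_genD => //; exact: ideal_genN.
by apply: agreeD => //; exact: agreeN.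
Qed.
HB.instance Definition _ :=
  GRing.isZmodClosed.Build (pathser K Q) (jac_ideal W) jac_ideal_zmod_closed.

Lemma jac_idealMl z x : x \in jac_ideal W -> z * x \in jac_ideal W.
Proof.
move/jac_idealP => hx; apply/jac_idealP => N; have [y ? ?] := hx N.
by exists (z * y); [exact: ideal_genMl | exact: agreeMl].
Qed.
Lemma jac_idealMr z x : x \in jac_ideal W -> x * z \in jac_ideal W.
Proof.
move/jac_idealP => hx; apply/jac_idealP => N; have [y ? ?] := hx N.
by exists (y * z); [exact: ideal_genMr | exact: agreeMr].
Qed.
Lemma jac_idealZ a x : x \in jac_ideal W -> a *: x \in jac_ideal W.
Proof. by move=> hx; rewrite -[x]mul1r ser_scalerAl jac_idealMl. Qed.
Lemma jac_ideal_cycder a : cycder a W \in jac_ideal W.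
Proof.
apply/jac_idealP => N; exists (cycder a W) => //.
by apply: ideal_gen_mem; exists a.
Qed.

(* Jac is equipped below with a ring and a K-module structure, compatible by
   jac_scalerAl and jac_scalerAr; it is not declared as an algType because this
   would require 1 != 0, which fails for some W (e.g. W = a on the quiver
   with one vertex and one loop a). *)
Definition Jac : Type :=
  Quotient.quot (GRing.ZmodClosed.clone (pathser K Q) (jac_ideal W) _).
HB.instance Definition _ := GRing.Zmodule.on Jac.
HB.instance Definition _ := EqQuotient.on Jac.

Definition toJac (x : pathser K Q) : Jac := \pi_Jac x.

Lemma toJac_eq x y : (toJac x = toJac y) <-> (x - y \in jac_ideal W).
Proof.
rewrite /toJac; split => [/eqP|h]; first by rewrite piE.
by apply/eqP; rewrite piE.
Qed.

Lemma toJacK (u : Jac) : toJac (repr u) = u.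
Proof. exact: reprK. Qed.

Lemma toJacD : {morph toJac : x y / x + y}.
Proof. by move=> x y; rewrite /toJac !piE. Qed.

Definition jac_one : Jac := toJac 1.
Definition jac_mul (u v : Jac) : Jac := toJac (repr u * repr v).
Definition jac_scale (a : K) (u : Jac) : Jac := toJac (a *: repr u).

Lemma repr_toJac x : repr (toJac x) - x \in jac_ideal W.
Proof. by apply/toJac_eq; rewrite toJacK. Qed.

Lemma toJac_mul x y : toJac (x * y) = jac_mul (toJac x) (toJac y).
Proof.
apply/esym/toJac_eq; set x' := repr _; set y' := repr _.
have -> : x' * y' - x * y = (x' - x) * y' + x * (y' - y).
  by rewrite mulrBl mulrBr addrA subrK.
apply: rpredD; [apply: jac_idealMr | apply: jac_idealMl]; exact: repr_toJac.
Qed.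

Lemma toJac_scale a x : toJac (a *: x) = jac_scale a (toJac x).
Proof.
apply/esym/toJac_eq; rewrite -scalerBr; apply: jac_idealZ; exact: repr_toJac.
Qed.

Fact jac_mulA : associative jac_mul.
Proof.
move=> u v w; rewrite -[u]toJacK -[v]toJacK -[w]toJacK.
by rewrite -!toJac_mul mulrA.
Qed.
Fact jac_mul1 : left_id jac_one jac_mul.
Proof. by move=> u; rewrite -[u]toJacK -toJac_mul mul1r. Qed.
Fact jac_mulr1 : right_id jac_one jac_mul.
Proof. by move=> u; rewrite -[u]toJacK -toJac_mul mulr1. Qed.
Fact jac_mulDl : left_distributive jac_mul +%R.
Proof.
move=> u v w; rewrite -[u]toJacK -[v]toJacK -[w]toJacK.
by rewrite -toJacD -!toJac_mul -toJacD mulrDl.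
Qed.
Fact jac_mulDr : right_distributive jac_mul +%R.
Proof.
move=> u v w; rewrite -[u]toJacK -[v]toJacK -[w]toJacK.
by rewrite -toJacD -!toJac_mul -toJacD mulrDr.
Qed.
HB.instance Definition _ := GRing.Zmodule_isPzRing.Build Jac
  jac_mulA jac_mul1 jac_mulr1 jac_mulDl jac_mulDr.

Fact jac_scaleA a b u : jac_scale a (jac_scale b u) = jac_scale (a * b) u.
Proof. by rewrite -[u]toJacK -!toJac_scale scalerA. Qed.
Fact jac_scale1 : left_id 1 jac_scale.
Proof. by move=> u; rewrite -[u]toJacK -toJac_scale scale1r. Qed.
Fact jac_scaleDr : right_distributive jac_scale +%R.
Proof.
move=> a u v; rewrite -[u]toJacK -[v]toJacK.
by rewrite -toJacD -!toJac_scale -toJacD scalerDr.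
Qed.
Fact jac_scaleDl u : {morph jac_scale^~ u : a b / a + b}.
Proof.
by move=> a b; rewrite -[u]toJacK -!toJac_scale -toJacD scalerDl.
Qed.
HB.instance Definition _ := GRing.Zmodule_isLmodule.Build K Jac
  jac_scaleA jac_scale1 jac_scaleDr jac_scaleDl.

Lemma jac_scalerAl (a : K) (u v : Jac) : a *: (u * v) = (a *: u) * v.
Proof.
rewrite -[u]toJacK -[v]toJacK.
change (jac_scale a (jac_mul (toJac (repr u)) (toJac (repr v))) =
  jac_mul (jac_scale a (toJac (repr u))) (toJac (repr v))).
by rewrite -!(toJac_mul, toJac_scale) ser_scalerAl.
Qed.
Lemma jac_scalerAr (a : K) (u v : Jac) : a *: (u * v) = u * (a *: v).
Proof.
rewrite -[u]toJacK -[v]toJacK.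
change (jac_scale a (jac_mul (toJac (repr u)) (toJac (repr v))) =
  jac_mul (toJac (repr u)) (jac_scale a (toJac (repr v)))).
by rewrite -!(toJac_mul, toJac_scale) ser_scalerAr.
Qed.

Fact toJac_is_zmod_morphism : zmod_morphism toJac.
Proof. by move=> x y; rewrite /toJac !piE. Qed.
Fact toJac_is_monoid_morphism : monoid_morphism toJac.
Proof. by split=> // x y; exact: toJac_mul. Qed.
Fact toJac_is_scalable : scalable toJac.
Proof. by move=> a x; exact: toJac_scale. Qed.
HB.instance Definition _ :=
  GRing.isZmodMorphism.Build (pathser K Q) Jac toJac toJac_is_zmod_morphism.
HB.instance Definition _ :=
  GRing.isMonoidMorphism.Build (pathser K Q) Jac toJac toJac_is_monoid_morphism.
HB.instance Definition _ :=
  GRing.isScalable.Build K (pathser K Q) Jac *:%R toJac toJac_is_scalable.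

End JacIdeal.

(* The sum of k_j x^j over j >= 2. It converges when x has no constant term,
   and then x^j has no paths of length less than j, which makes the sum below
   the coefficient of the limit: see powsum_limit. *)
Definition powsum_coef (k : nat -> K) (x : pathser K Q)
    (v : vertex Q) (s : seq (arrow Q)) : K :=
  \sum_(2 <= j < (size s).+1) k j * (x ^+ j) v s.

Fact powsum_supp k x v s : ~~ is_path v s -> powsum_coef k x v s = 0.
Proof. by move=> h; apply: big1 => j _; rewrite coef_supp ?mulr0. Qed.
Definition powsum k x := PathSer (@powsum_supp k x).

Lemma coef_exp_small x j v s :
  (forall w, x w [::] = 0) -> (size s < j)%N -> (x ^+ j) v s = 0.
Proof.
move=> x0; elim: j v s => // j IH v s sj; rewrite exprS coefM.
rewrite big_ord_recl take0 x0 mul0r add0r big1 // => k _.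
rewrite IH ?mulr0 // size_drop lift0.
by case: s sj k => [|c s] sj [k kP] //=; rewrite subSS (leq_ltn_trans (leq_subr _ _)).
Qed.

Lemma powsum_limit k x : (forall w, x w [::] = 0) ->
  adic_limit (fun M => \sum_(2 <= j < M) k j *: x ^+ j) (powsum k x).
Proof.
move=> x0 N; exists N.+1 => M NM v s sN; rewrite coef_sum /= /powsum_coef.
have sM : ((size s).+1 <= M)%N by apply: leq_trans NM; exact: ltnW.
case: (leqP 2 (size s).+1) => h.
  rewrite (big_cat_nat h sM) /= [X in _ + X]big_nat_cond [X in _ + X]big1 ?addr0 //.
  by move=> j; rewrite andbT => /andP[sj _]; rewrite coef_exp_small ?mulr0.
rewrite (big_geq (n := (size s).+1)) 1?ltnW // big_nat_cond big1 // => j.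
rewrite andbT => /andP[j2 _]; rewrite coef_exp_small ?mulr0 //.
exact: leq_trans (ltnW h) j2.
Qed.

End CompletedPathAlgebra.

Definition jac_iso (K : fieldType) (Q1 Q2 : quiver)
    (W1 : pathser K Q1) (W2 : pathser K Q2) : Prop :=
  exists phi : {rmorphism Jac W1 -> Jac W2}, scalable phi /\ bijective phi.

Section TypeA.
Variables (n : nat) (I : {set 'I_n}).

(* The vertices 1, ..., n are represented by 0, ..., n-1. *)
Definition pair_lo (j : 'I_n.-1) : 'I_n := widen_ord (leq_pred n) j.

Fact pair_hi_subproof (j : 'I_n.-1) : (j.+1 < n)%N.
Proof. by case: n j => [|m] [j]. Qed.
Definition pair_hi (j : 'I_n.-1) : 'I_n := Ordinal (pair_hi_subproof j).

Inductive member := Loop of {i : 'I_n | i \notin I} | Pair of 'I_n.-1.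

Definition typeA_arrow : finType :=
  ('I_n.-1 + 'I_n.-1 + {i : 'I_n | i \notin I})%type.
Definition fwd (j : 'I_n.-1) : typeA_arrow := inl (inl j).
Definition bwd (j : 'I_n.-1) : typeA_arrow := inl (inr j).
Definition loop (l : {i : 'I_n | i \notin I}) : typeA_arrow := inr l.

Definition typeA_tail (c : typeA_arrow) : 'I_n :=
  match c with
  | inl (inl j) => pair_lo j
  | inl (inr j) => pair_hi j
  | inr l => val l
  end.
Definition typeA_head (c : typeA_arrow) : 'I_n :=
  match c with
  | inl (inl j) => pair_hi j
  | inl (inr j) => pair_lo j
  | inr l => val l
  end.
Definition typeA_quiver : quiver := Quiver typeA_tail typeA_head.

Definition members_at (i : 'I_n) : seq member :=
  (if insub i is Some l then [:: Loop l] else [::]) ++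
  (if insub (val i) is Some j then [:: Pair j] else [::]).
Definition members : seq member := flatten [seq members_at i | i <- enum 'I_n].

Definition typeA_length : nat := (2 * n - 1 - #|I|)%N.

Lemma size_members_at i : size (members_at i) = ((i \notin I) + (i < n.-1))%N.
Proof.
rewrite size_cat; congr (_ + _)%N.
  by case: insubP => [l -> _|/negPf ->].
by case: insubP => [l -> _|/negPf ->].
Qed.

Lemma size_members : size members = typeA_length.
Proof.
rewrite /members size_flatten /shape -map_comp sumnE big_map big_enum /=.
under eq_bigr do rewrite size_members_at.
have -> : (\sum_(i : 'I_n) ((i \notin I) + (i < n.-1)) =
  #|~: I| + n.-1)%N.
  rewrite big_split /=; congr (_ + _)%N.
    by rewrite -sum1_card [RHS]big_mkcond; apply: eq_bigr => i _; rewrite inE; case: (i \in I).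
  case: (n) => [|m]; first by rewrite big_ord0.
  rewrite big_ord_recr /= ltnn addn0.
  by rewrite (eq_bigr (fun=> 1%N)) ?sum1_card ?card_ord // => i _; rewrite ltn_ord.
have := cardsC I; rewrite card_ord /typeA_length.
by move: #|I| #|~: I| => p q; lia.
Qed.

Variable K : fieldType.

Definition mem_a (e : member) : pathser K typeA_quiver :=
  match e with
  | Loop l => ser_arrow K (loop l : arrow typeA_quiver)
  | Pair j => ser_arrow K (fwd j : arrow typeA_quiver)
  end.
Definition mem_b (e : member) : pathser K typeA_quiver :=
  match e with
  | Loop l => ser_triv K (val l : vertex typeA_quiver)
  | Pair j => ser_arrow K (bwd j : arrow typeA_quiver)
  end.

(* xx k is x_k = a_k b_k and xx' k is x_k' = b_k a_k.
   Indexed from 1: only 1 <= k <= typeA_length is meaningful. *)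
Definition xx (k : nat) : pathser K typeA_quiver :=
  nth 0 [seq mem_a e * mem_b e | e <- members] k.-1.
Definition xx' (k : nat) : pathser K typeA_quiver :=
  nth 0 [seq mem_b e * mem_a e | e <- members] k.-1.

Definition monomialized (kappa : nat -> nat -> K) : pathser K typeA_quiver :=
  \sum_(1 <= i < typeA_length) xx' i * xx i.+1 +
  \sum_(1 <= i < typeA_length.+1) powsum (kappa i) (xx i).

Lemma mem_ab_closed e v s :
  (mem_a e * mem_b e) v s != 0 \/ (mem_b e * mem_a e) v s != 0 ->
  path_end v s = v.
Proof.
have P (c : arrow typeA_quiver) u (t : seq (arrow typeA_quiver)) :
    ser_arrow K c u t != 0 -> u = tail c /\ t = [:: c].
  by rewrite /=; case: and3P => [[_ /eqP-> /eqP->]|]; rewrite ?eqxx.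
have T (w : vertex typeA_quiver) u (t : seq (arrow typeA_quiver)) :
    ser_triv K w u t != 0 -> u = w /\ t = [::].
  by rewrite /=; case: andP => [[/eqP-> /eqP->]|]; rewrite ?eqxx.
have M (x y : pathser K typeA_quiver) :
    (x * y) v s != 0 -> exists t t', [/\ s = t ++ t', x v t != 0 &
                                      y (path_end v t) t' != 0].
  rewrite coefM => h.
  have [k /andP[]|h0] := pickP (fun k : 'I_(size s).+1 => (x v (take k s) != 0) &&
     (y (path_end v (take k s)) (drop k s) != 0)); last first.
    rewrite big1 ?eqxx // in h => k _; apply/eqP; rewrite mulf_eq0.
    by have /negbT := h0 k; rewrite negb_and !negbK.
  by exists (take k s), (drop k s); rewrite cat_take_drop.
case: e => l [] /M[t [t' [->]]].
- by move=> /P[-> ->] /T[_ ->].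
- by move=> /T[-> ->] /P[_ ->].
- by move=> /P[-> ->] /P[_ ->].
- by move=> /P[-> ->] /P[_ ->].
Qed.

Lemma xx_const0 k v : xx k v [::] = 0.
Proof.
rewrite /xx; elim: members k.-1 => [|e r IH] [|j] //=.
rewrite conv_nil; case: e => ? /=; rewrite ?andbF ?mul0r //.
Qed.

Lemma monomialized_potential kappa : is_potential (monomialized kappa).
Proof.
pose cyc (x : pathser K typeA_quiver) := forall v s, x v s != 0 ->
  path_end v s = v.
have cycD x y : cyc x -> cyc y -> cyc (x + y).
  move=> hx hy v s; have [x0|/hx //] := eqVneq (x v s) 0.
  by rewrite coefD x0 add0r => /hy.
have cyc0 : cyc 0 by move=> v s; rewrite coef0 eqxx.
have cycM x y : cyc x -> cyc y -> cyc (x * y).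
  move=> hx hy v s; apply: contra_neq_eq => hs; rewrite coefM.
  apply: big1 => k _; apply/eqP; rewrite mulf_eq0; apply/norP => -[hk hk'].
  case/eqP: hs; rewrite -(cat_take_drop k s) /path_end map_cat last_cat.
  by rewrite -[last v _]/(path_end v _) (hx _ _ hk);
     move/hy: hk'; rewrite (hx _ _ hk).
have cycx k : cyc (xx k) /\ cyc (xx' k).
  by split; rewrite /xx /xx'; elim: members k.-1 => [|e r IH] [|j] //= v s h;
     apply: (mem_ab_closed (e := e)); [left | right].
have cycX k j : cyc (xx k ^+ j).
  elim: j => [|j IH]; last by rewrite exprS; apply: cycM => //; case: (cycx k).
  by move=> v s; rewrite expr0 coef1; case: s => //=; rewrite eqxx.
move=> v s h; split.
  apply: contra_neq h => ->; rewrite coefD !coef_sum.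
  rewrite big1 ?add0r => [|k _]; last first.
    by rewrite coefM big_ord_recl big_ord0 take0 drop0 xx_const0 mulr0 addr0.
  by rewrite big1 // => k _; rewrite /= /powsum_coef big_geq.
suff: cyc (monomialized kappa) by apply.
apply: (cycD); (apply: (big_ind cyc); [exact: cyc0 | exact: cycD | ]) => k _.
  by apply: cycM; have [] := cycx k; have [] := cycx k.+1.
move=> u t; apply: contra_neq_eq => ht; apply: big1 => j _ /=.
by apply/eqP; rewrite mulf_eq0 orbC; apply/orP; left; apply: contraNT ht => /cycX->.
Qed.

End TypeA.

Lemma nth_flatten_double (T : Type) (x0 : T) (ss : seq (seq T)) i :
  (forall j, (j < i)%N -> size (nth [::] ss j) = 2) ->
  nth x0 (flatten ss) (2 * i) = nth x0 (nth [::] ss i ++ flatten (drop i.+1 ss)) 0.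
Proof.
elim: i ss => [|i IH] [|s ss] h //=; first by rewrite drop0.
rewrite nth_cat (h 0%N erefl) mulnS addKn -IH // => j ji.
exact: (h j.+1).
Qed.

(* In Q_n the loop at the i-th vertex is the member number 2i-1 of the list. *)
Lemma xx_loop n (K : fieldType) (i : 'I_n) (hi : i \notin finset.set0) :
  xx finset.set0 K (2 * i.+1 - 1) =
  ser_arrow K (loop (Sub i hi) : arrow (typeA_quiver finset.set0)).
Proof.
rewrite /xx /members map_flatten -map_comp.
have -> : (2 * i.+1 - 1).-1 = (2 * i)%N by lia.
have E (j : 'I_n) : (j < n.-1)%N -> size (members_at finset.set0 j) = 2.
  by move=> h; rewrite size_members_at finset.in_set0 h.
rewrite nth_flatten_double => [|j ji]; last first.
  have jn := ltn_trans ji (ltn_ord i).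
  rewrite (nth_map i) ?size_enum_ord //= size_map E // nth_enum_ord //.
  by have := ltn_ord i; lia.
rewrite (nth_map i) ?size_enum_ord // nth_ord_enum /= /members_at insubT /=.
exact: ser_arrow_triv.
Qed.

(* Main.v *)
From HB Require Import structures.
From mathcomp Require Import all_boot all_order all_algebra complex.
From mathcomp Require Import zify ring boolp reals.
Require Import Defs.

Set Implicit Arguments.
Unset Strict Implicit.
Unset Printing Implicit Defensive.

Import GRing.Theory.
Local Open Scope ring_scope.
Local Open Scope complex_scope.

(** The potential on I is obtained from one on the full quiver by eliminating
    quadratic loops. At a vertex i of I give the loop c of Q_n the potential
    - c^2 / 2 and no higher term. In Q_n the derivative by c is then L + R - c,
    where L and R are the round trips from i through its left and right
    neighbours (x' of the pair on the left, x of the pair on the right). So c is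
    redundant in the Jacobi algebra: it equals L + R. Substituting L + R for c in
      L c + c R - c^2 / 2
    gives, up to cyclic permutation, L R + L^2 / 2 + R^2 / 2. The product L R is
    the term that f has at i, and the two squares are absorbed into the quadratic
    coefficients of the two neighbouring pairs: the coefficient of the pair
    between i and i+1 is lowered by 1/2 for each of i and i+1 that lies in I. The
    squares match because the two round trips a b and b a of a pair have
    cyclically equivalent squares. All other coefficients are copied from f.

    Formally, the substitution elim sends the loop c at i in I to L + R and fixes
    the other arrows; incl is the inclusion of the arrows of Q_{n,I}. The
    composite of incl and then elim is the identity, and the other composite is
    the identity modulo the Jacobi ideal of g, so both induce inverse maps of
    Jacobi algebras (jac_iso_subst) as soon as elim matches the cyclic
    derivatives of g with those of f. That follows from the chain rule
    (insder_subst): the derivative of the substituted potential by a is a sum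
    over the arrows c of Q_n of contributions of the substituted derivatives by c.
    Those of the eliminated loops vanish, since c - L - R goes to 0, and only the
    arrow a itself remains (subst_elim_cycder).

    Two devices carry the general theory. A series is determined by its constant
    terms and its left quotients by the arrows (series_decomp), so identities
    between continuous maps are proved by induction on the degree of precision.
    And the cyclic derivative is generalised to an operation insder a W u that
    writes u in the place where the word is closed up; it satisfies the Leibniz
    rule insderM, which the cyclic derivative alone does not. *)

(** * Left quotients and the recursive description of a series *)

Section LeftQuotient.
Variables (K : fieldType) (Q : quiver).
Implicit Types (x y z : pathser K Q) (a c : arrow Q) (v w : vertex Q).

Lemma agree_sym N x y : agree N x y -> agree N y x.
Proof. by move=> h v s sN; rewrite h. Qed.

Lemma agree_trans N x y z : agree N x y -> agree N y z -> agree N x z.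
Proof. by move=> h h' v s sN; rewrite h // h'. Qed.

Lemma agree_le M N x y : (M <= N)%N -> agree N x y -> agree M x y.
Proof. by move=> MN h v s sM; apply: h; apply: leq_trans MN. Qed.

Lemma agree_sum N (J : Type) (r : seq J) (P : pred J) (F G : J -> pathser K Q) :
  (forall j, P j -> agree N (F j) (G j)) ->
  agree N (\sum_(j <- r | P j) F j) (\sum_(j <- r | P j) G j).
Proof.
by move=> h v s sN; rewrite !coef_sum; apply: eq_bigr => j Pj; apply: h.
Qed.

Lemma agree_sum0 N (J : Type) (r : seq J) (P : pred J) (F : J -> pathser K Q) :
  (forall j, P j -> agree N (F j) 0) -> agree N (\sum_(j <- r | P j) F j) 0.
Proof.
by move=> h v s sN; rewrite coef_sum; apply: big1 => j Pj; rewrite h.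
Qed.

Lemma agree_eq x y : (forall N, agree N x y) -> x = y.
Proof. by move=> h; apply: pathserP => v s; apply: (h (size s).+1). Qed.

Lemma coef_consM x y v c s :
  (x * y) v (c :: s) =
  x v [::] * y v (c :: s) + conv (fun t => x v (c :: t)) y (head c) s.
Proof. exact: conv_cons. Qed.

(** A factor without constant term raises the precision by one: this is the
    induction step of all the arguments by degree below. *)
Lemma agreeMl_lift N z x y :
  (forall v, z v [::] = 0) -> agree N x y -> agree N.+1 (z * x) (z * y).
Proof.
move=> z0 h v [|c s] sN; first by rewrite [LHS]conv_nil [RHS]conv_nil z0 !mul0r.
rewrite !coef_consM z0 !mul0r !add0r; apply: eq_bigr => k _; rewrite h //.
by rewrite size_drop (leq_ltn_trans (leq_subr _ _)).
Qed.

Lemma coef_trivM w y v s : (ser_triv K w * y) v s = (v == w)%:R * y v s.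
Proof.
case: s => [|c s]; first by rewrite [LHS]conv_nil /= andbT.
rewrite coef_consM /= andbT [conv _ _ _ _]big1 ?addr0 // => k _.
by rewrite /= andbF mul0r.
Qed.

Lemma agreeMr_lift N z x y :
  (forall v, z v [::] = 0) -> agree N x y -> agree N.+1 (x * z) (y * z).
Proof.
move=> z0 h v s sN; rewrite !coefM; apply: eq_bigr => k _.
have [ks|sk] := ltnP k (size s); last by rewrite drop_oversize // z0 !mulr0.
by rewrite h // size_take ks (leq_trans ks).
Qed.

Lemma triv_idem w : ser_triv K w * ser_triv K w = ser_triv K w.
Proof.
by apply: pathserP => v s; rewrite coef_trivM /=; case: eqP; rewrite ?mul1r ?mul0r.
Qed.

Lemma coef_arrowM c y v d s :
  (ser_arrow K c * y) v (d :: s) = ((v == tail c) && (d == c))%:R * y (head d) s.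
Proof.
rewrite coef_consM /= !andbF mul0r add0r /conv big_ord_recl take0 drop0 /=.
rewrite !eqseq_cons !eqxx !andbT [X in _ + X]big1 ?addr0 // => k _.
by case: s k => [[]|e s k] //=; rewrite !eqseq_cons !andbF mul0r.
Qed.

Lemma ser_arrow_const c v : ser_arrow K c v [::] = 0.
Proof. by rewrite /= !andbF. Qed.

Lemma triv_arrow c : ser_triv K (tail c) * ser_arrow K c = ser_arrow K c.
Proof.
apply: pathserP => v s; rewrite coef_trivM /= eqxx /=.
by case: (v == _); rewrite ?mul1r ?mul0r.
Qed.

Lemma arrow_ends c :
  ser_triv K (tail c) * ser_arrow K c * ser_triv K (head c) = ser_arrow K c.
Proof. by rewrite triv_arrow ser_arrow_triv. Qed.

Fact diag_supp (x : vertex Q -> seq (arrow Q) -> K) v s :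
  ~~ is_path v s -> (if s is [::] then x v [::] else 0) = 0.
Proof. by case: s. Qed.

Fact lquo_supp c x v s :
  ~~ is_path v s -> (if v == head c then x (tail c) (c :: s) else 0) = 0.
Proof.
case: eqP => // -> h; apply: coef_supp.
by rewrite is_path_cons (negPf h) andbF.
Qed.
(** Left division by the arrow c: the part of x made of the paths that begin
    with c, with this c removed. *)
Definition lquo c x := PathSer (@lquo_supp c x).

Fact lquo_linear c : linear (lquo c).
Proof.
move=> k x y; apply: pathserP => v s; rewrite coefD coefZ /=.
by case: eqP => // _; rewrite mulr0 addr0.
Qed.
HB.instance Definition _ c :=
  GRing.isLinear.Build K (pathser K Q) (pathser K Q) _ (lquo c) (lquo_linear c).

Lemma lquo_agree N c x y : agree N.+1 x y -> agree N (lquo c x) (lquo c y).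
Proof. by move=> h v s sN /=; case: eqP => // _; apply: h. Qed.

Lemma triv_lquo c x : ser_triv K (head c) * lquo c x = lquo c x.
Proof.
apply: pathserP => v s; rewrite coef_trivM /=.
by case: eqP => _; rewrite ?mul1r ?mul0r.
Qed.

Lemma lquo1 c : lquo c 1 = 0.
Proof. by apply: pathserP => v s /=; case: ifP. Qed.

Lemma lquo_arrow c d : lquo c (ser_arrow K d) = (c == d)%:R *: ser_triv K (head d).
Proof.
apply: pathserP => v s; rewrite coefZ /= eqxx /= eqseq_cons.
case: (eqVneq c d) => [->|_]; last by rewrite andbF mul0r; case: ifP.
by rewrite mul1r eqxx /=; case: ifP.
Qed.

(** Either c is the first arrow of the factor from x, or this factor is the
    trivial path at the tail of c. *)
Lemma lquoM c x y :
  lquo c (x * y) = lquo c x * y + x (tail c) [::] *: lquo c y.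
Proof.
apply: pathserP => v s; rewrite coefD coefZ addrC.
rewrite -[LHS]/(if v == head c then (x * y) (tail c) (c :: s) else 0).
case: eqP => [->|/eqP/negPf hv]; last first.
  by rewrite -[lquo c x]triv_lquo -mulrA coef_trivM /= hv mulr0 mul0r addr0.
by rewrite coef_consM /= eqxx; congr (_ + _).
Qed.

End LeftQuotient.

Section Diagonal.
Variables (K : fieldType) (V A A' : finType).
Variables (t h : A -> V) (t' h' : A' -> V).
Let Q := Quiver t h.
Let Q' := Quiver t' h'.

(** The constant terms of x, read in another quiver on the same vertices so that
    they can serve as the constant terms of an image of x. *)
Definition diag (x : pathser K Q) : pathser K Q' :=
  PathSer (@diag_supp K Q' (fun v _ => x v [::])).

Fact diag_linear : linear diag.
Proof.
move=> k x y; apply: pathserP => v [|c s]; rewrite coefD coefZ //=.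
by rewrite mulr0 addr0.
Qed.
HB.instance Definition _ :=
  GRing.isLinear.Build K (pathser K Q) (pathser K Q') _ diag diag_linear.

Lemma diagM x y : diag (x * y) = diag x * diag y.
Proof.
apply: pathserP => v [|c s]; first by rewrite [RHS]conv_nil /= conv_nil.
by rewrite coef_consM /= mulr0 add0r [conv _ _ _ _]big1 // => k _; rewrite mul0r.
Qed.

Lemma diag1 : diag 1 = 1.
Proof. by apply: pathserP => v [|c s]. Qed.

Lemma diag_triv v : diag (ser_triv K (v : vertex Q)) = ser_triv K (v : vertex Q').
Proof. by apply: pathserP => w [|c s] //=; rewrite andbF. Qed.

Lemma diag_arrow c : diag (ser_arrow K (c : arrow Q)) = 0.
Proof. by apply: pathserP => w [|d s] //=; rewrite !andbF. Qed.

Lemma diag_trivM x v z : diag x * (ser_triv K (v : vertex Q') * z) =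
  x v [::] *: (ser_triv K (v : vertex Q') * z).
Proof.
apply: pathserP => w s; rewrite coefZ coefM big_ord_recl take0 drop0.
rewrite big1 ?addr0 => [|k _]; last by case: s k => [[]|c s k] //=; rewrite mul0r.
rewrite !coef_trivM /= /path_end /=.
by case: eqP => [->|_] //; rewrite !mul0r !mulr0.
Qed.

End Diagonal.

Lemma series_decomp (K : fieldType) (V A : finType) (t h : A -> V)
    (x : pathser K (Quiver t h)) :
  x = diag t h x + \sum_c ser_arrow K (c : arrow (Quiver t h)) * lquo c x.
Proof.
apply: pathserP => v [|d s]; rewrite coefD coef_sum.
  by rewrite big1 ?addr0 // => c _; rewrite [LHS]conv_nil /= !andbF mul0r.
rewrite add0r; have [hv|hv] := eqVneq v (t d); last first.
  rewrite big1 ?coef_supp //; first by rewrite is_path_cons /= eq_sym (negPf hv).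
  by move=> c _; rewrite coef_arrowM; case: (eqVneq d c) hv => [->|_] /negPf hv; rewrite ?hv ?andbF mul0r.
rewrite (bigD1 d) // big1 => [|c /andP[_ /negPf cd]]; rewrite coef_arrowM.
  by rewrite hv !eqxx /= eqxx mul1r addr0.
by rewrite (eq_sym d) cd andbF mul0r.
Qed.

(** * Continuous substitutions *)
Section Substitution.
Variables (K : fieldType) (V A A' : finType).
Variables (t h : A -> V) (t' h' : A' -> V).
Let Q := Quiver t h.
Let Q' := Quiver t' h'.

(** The data of a continuous morphism that fixes the vertices: the arrow c goes to
    a series of paths from its tail to its head. The absence of constant terms
    makes the morphism converge on infinite series. *)
Record substitution := Substitution {
  image :> A -> pathser K Q';
  image_const0 : forall c v, image c v [::] = 0;
  image_ends : forall c, ser_triv K (t c : vertex Q') * image c *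
                 ser_triv K (h c : vertex Q') = image c
}.

Variable F : substitution.
Implicit Types x y : pathser K Q.

Lemma image_tail c : ser_triv K (t c : vertex Q') * F c = F c.
Proof.
by rewrite -{2}image_ends -{1}image_ends !mulrA triv_idem.
Qed.

Lemma image_head c : F c * ser_triv K (h c : vertex Q') = F c.
Proof. by rewrite -{2}image_ends -{1}image_ends -!mulrA triv_idem. Qed.

(** Splitting off the first arrow turns the substitution into a recursion in
    which N steps determine the coefficients of the paths of length less than
    N. *)
Fixpoint subst_upto N x : pathser K Q' :=
  if N is N'.+1 then
    diag t' h' x + \sum_(c : arrow Q) F c * subst_upto N' (lquo c x)
  else 0.

Lemma subst_upto_agree N M x :
  (N <= M)%N -> agree N (subst_upto M x) (subst_upto N x).
Proof.
elim: N M x => // N IH [|M] x //; rewrite ltnS => NM /=.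
apply: agreeD => //; apply: agree_sum => c _.
by apply: agreeMl_lift; [exact: image_const0 | exact: IH].
Qed.

Fact subst_supp x v s :
  ~~ is_path v s -> subst_upto (size s).+1 x v s = 0.
Proof. exact: coef_supp. Qed.

Definition subst x : pathser K Q' := PathSer (@subst_supp x).

Lemma substE N x : agree N (subst x) (subst_upto N x).
Proof. by move=> v s sN /=; rewrite (subst_upto_agree x sN). Qed.

Lemma subst_rec x :
  subst x = diag t' h' x + \sum_(c : arrow Q) F c * subst (lquo c x).
Proof.
apply: agree_eq => N; apply: (agree_trans (agree_le (leqnSn N) (@substE N.+1 x))).
apply: agreeD => //; apply: agree_sum => c _.
by apply: agreeMl; apply: agree_sym; exact: substE.
Qed.

(** Each unfolding of the recursion gains one degree of precision, as the images
    of arrows have no constant term. This is how maps are recognised below as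
    substitutions. *)
Lemma subst_unique (u : pathser K Q -> pathser K Q') :
  (forall x, u x = diag t' h' x + \sum_(c : arrow Q) F c * u (lquo c x)) ->
  forall x, u x = subst x.
Proof.
move=> uE x; apply: agree_eq => N; elim: N x => // N IH x.
rewrite uE subst_rec; apply: agreeD => //; apply: agree_sum => c _.
by apply: agreeMl_lift; [exact: image_const0 | exact: IH].
Qed.

Fact subst_linear : linear subst.
Proof.
move=> k x y; apply: agree_eq => N; elim: N x y => // N IH x y.
rewrite !subst_rec linearP scalerDr addrACA; apply: agreeD => //.
rewrite scaler_sumr -big_split; apply: agree_sum => c _.
rewrite linearP/= ser_scalerAr -mulrDr.
by apply: agreeMl_lift; [exact: image_const0 | exact: IH].
Qed.
HB.instance Definition _ :=
  GRing.isLinear.Build K (pathser K Q) (pathser K Q') _ subst subst_linear.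

Lemma diag_image x c : diag t' h' x * F c = x (t c) [::] *: F c.
Proof. by rewrite -image_tail diag_trivM. Qed.

Fact subst_monoid : monoid_morphism subst.
Proof.
split=> [|x y].
  rewrite subst_rec diag1 big1 ?addr0 // => c _.
  by rewrite lquo1 linear0 mulr0.
apply: agree_eq => N; elim: N x y => // N IH x y.
rewrite [subst (x * y)]subst_rec [subst x]subst_rec mulrDl.
rewrite [X in agree _ _ (_ * X + _)]subst_rec mulrDr -diagM -addrA.
apply: agreeD => //.
rewrite mulr_sumr mulr_suml -big_split; apply: agree_sum => c _.
rewrite lquoM linearD linearZ mulrDr addrC [_ * (_ * _)]mulrA diag_image.
rewrite -ser_scalerAl ser_scalerAr; apply: agreeD => //.
by rewrite -mulrA; apply: agreeMl_lift; [exact: image_const0 | exact: IH].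
Qed.
HB.instance Definition _ := GRing.isMonoidMorphism.Build
  (pathser K Q) (pathser K Q') subst subst_monoid.

Lemma subst_agree N x y : agree N x y -> agree N (subst x) (subst y).
Proof.
elim: N x y => // N IH x y xy; rewrite !subst_rec; apply: agreeD.
  by move=> v [|c s] // _ /=; apply: xy.
apply: agree_sum => c _; apply: agreeMl_lift; first exact: image_const0.
by apply: IH; apply: lquo_agree.
Qed.

Lemma subst_agree0 N x : agree N x 0 -> agree N (subst x) 0.
Proof. by move/subst_agree; rewrite linear0. Qed.

Lemma subst_triv v : subst (ser_triv K (v : vertex Q)) = ser_triv K (v : vertex Q').
Proof.
rewrite subst_rec diag_triv big1 ?addr0 // => c _.
rewrite (_ : lquo c _ = 0) ?linear0 ?mulr0 //.
by apply: pathserP => w s /=; rewrite andbF; case: ifP.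
Qed.

Lemma subst_arrow c : subst (ser_arrow K (c : arrow Q)) = F c.
Proof.
rewrite subst_rec diag_arrow add0r (bigD1 c) //= big1 => [|d /negPf dc].
  by rewrite lquo_arrow eqxx scale1r subst_triv image_head addr0.
by rewrite lquo_arrow dc scale0r linear0 mulr0.
Qed.

Lemma subst_const0 x : (forall v, x v [::] = 0) -> forall v, subst x v [::] = 0.
Proof.
move=> x0 v; rewrite -[RHS](coef0 K (v : vertex Q') [::]) -(linear0 subst).
apply: (@subst_agree 1) => // w s; rewrite ltnS leqn0 => /nilP ->; exact: x0.
Qed.

End Substitution.

(** An effective form of powsum_limit: the terms of exponent above M only contain
    paths of length above M. *)
Lemma powsum_agree (K : fieldType) (Q : quiver) (k : nat -> K) N M
    (x : pathser K Q) : (forall v, x v [::] = 0) -> (N <= M)%N ->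
  agree N (powsum k x) (\sum_(2 <= j < M.+1) k j *: x ^+ j).
Proof.
move=> x0 NM v s sN; rewrite coef_sum /= /powsum_coef.
have sM : ((size s).+1 <= M.+1)%N by rewrite ltnS (leq_trans (ltnW sN)).
case: (leqP 2 (size s).+1) => hs.
  rewrite (big_cat_nat hs sM) /= [X in _ = _ + X]big_nat_cond.
  rewrite [X in _ = _ + X]big1 ?addr0 // => j.
  by rewrite andbT => /andP[sj _]; rewrite coef_exp_small ?mulr0.
rewrite (big_geq (n := (size s).+1)) 1?ltnW // big_nat_cond big1 // => j.
rewrite andbT => /andP[j2 _]; rewrite coef_exp_small ?mulr0 //.
exact: leq_trans (ltnW hs) j2.
Qed.

Section SubstitutionTheory.
Variables (K : fieldType) (V A A' : finType).
Variables (t h : A -> V) (t' h' : A' -> V).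
Let Q := Quiver t h.
Let Q' := Quiver t' h'.

Lemma subst_powsum (F : substitution K t h t' h') k (x : pathser K Q) :
  (forall v, x v [::] = 0) -> subst F (powsum k x) = powsum k (subst F x).
Proof.
move=> x0; apply: agree_eq => N.
have h0 := powsum_agree k x0 (leqnn N).
have h1 := powsum_agree k (subst_const0 F x0) (leqnn N).
apply: agree_trans (subst_agree F h0) _.
rewrite linear_sum; apply: agree_trans (agree_sym h1).
by under eq_bigr do rewrite linearZ rmorphXn.
Qed.

(** Telescoping the first arrow, a difference of products F c * F y - G c * G y is
    (F c - G c) * F y + G c * (F y - G y); the first summand lies in the ideal, and
    the second is handled with one more degree of precision. Closedness of the
    ideal then gives the exact statement. *)
Lemma subst_congr (F G : substitution K t h t' h') (P : pathser K Q' -> Prop) :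
  P 0 -> (forall x y, P x -> P y -> P (x + y)) ->
  (forall x y, P x -> P (x * y)) -> (forall x y, P y -> P (x * y)) ->
  (forall x, (forall N, exists2 y, P y & agree N x y) -> P x) ->
  (forall c, P (F c - G c)) ->
  forall x, P (subst F x - subst G x).
Proof.
move=> P0 PD PMr PMl Pcl PFG x; apply: Pcl => N.
elim: N x => [|N IH] x; first by exists 0.
have /choice[y hy] : forall c, exists y, P y /\
    agree N (subst F (lquo c x) - subst G (lquo c x)) y.
  by move=> c; have [y] := IH (lquo (c : arrow Q) x); exists y.
exists (\sum_(c : arrow Q) ((F c - G c) * subst F (lquo c x) + G c * y c)).
  by apply: (big_ind P) => // c _; apply: PD; [exact: PMr | apply: PMl; case: (hy c)].
rewrite (subst_rec F) (subst_rec G) opprD addrACA subrr add0r -sumrB.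
apply: agree_sum => c _.
have -> : F c * subst F (lquo c x) - G c * subst G (lquo c x) =
  (F c - G c) * subst F (lquo c x) + G c * (subst F (lquo c x) - subst G (lquo c x)).
  by rewrite mulrBl mulrBr addrA subrK.
apply: agreeD => //; apply: agreeMl_lift; first exact: image_const0.
by case: (hy c).
Qed.

End SubstitutionTheory.

Section Composition.
Variables (K : fieldType) (V A A' A2 : finType).
Variables (t h : A -> V) (t' h' : A' -> V) (t2 h2 : A2 -> V).
Variables (F : substitution K t h t' h') (G : substitution K t' h' t2 h2).

Fact comp_const0 c v : subst G (F c) v [::] = 0.
Proof. by apply: subst_const0; apply: image_const0. Qed.

Fact comp_ends c :
  ser_triv K (t c : vertex (Quiver t2 h2)) * subst G (F c) *
    ser_triv K (h c : vertex (Quiver t2 h2)) = subst G (F c).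
Proof. by rewrite -!(subst_triv G) -!rmorphM image_ends. Qed.

Definition subst_comp : substitution K t h t2 h2 := Substitution comp_const0 comp_ends.

Lemma subst_compE x : subst G (subst F x) = subst subst_comp x.
Proof.
apply: (subst_unique (u := fun x => subst G (subst F x))) => {}x.
rewrite (subst_rec F) linearD linear_sum; congr (_ + _).
  rewrite /= subst_rec big1 ?addr0 => [|c _].
    by apply: pathserP => v [|c s].
  by rewrite (_ : lquo c _ = 0) ?linear0 ?mulr0 //; apply: pathserP => v s /=; case: ifP.
by apply: eq_bigr => c _; rewrite /= rmorphM.
Qed.

End Composition.

Section Identity.
Variables (K : fieldType) (V A : finType) (t h : A -> V).
Let Q := Quiver t h.

Fact id_ends c : ser_triv K (t c : vertex Q) * ser_arrow K (c : arrow Q) *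
  ser_triv K (h c : vertex Q) = ser_arrow K (c : arrow Q).
Proof. exact: (@arrow_ends K Q). Qed.

Definition subst_id : substitution K t h t h :=
  Substitution (fun c => @ser_arrow_const K Q c) id_ends.

Lemma subst_idE x : subst subst_id x = x.
Proof.
apply/esym; apply: (subst_unique (u := id)) => {}x; exact: series_decomp.
Qed.

End Identity.

(** * Cyclic derivatives with an insertion *)
Section Cuts.
Variables (R : pzRingType) (T : Type).
Implicit Types (f : seq T -> seq T -> R) (s p r : seq T).

(** The product of series and the insertion derivative are both sums over cuts; the
    lemmas below are what is needed to rearrange iterated ones. *)
Definition cutsum f s : R := \sum_(k < (size s).+1) f (take k s) (drop k s).

Lemma cutsum_nil f : cutsum f [::] = f [::] [::].
Proof. by rewrite /cutsum big_ord_recl big_ord0 addr0. Qed.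

Lemma cutsum_cons f c s :
  cutsum f (c :: s) = f [::] (c :: s) + cutsum (fun p r => f (c :: p) r) s.
Proof. by rewrite /cutsum big_ord_recl. Qed.

Lemma eq_cutsum f g s :
  (forall p r, s = p ++ r -> f p r = g p r) -> cutsum f s = cutsum g s.
Proof. by move=> fg; apply: eq_bigr => k _; apply: fg; rewrite cat_take_drop. Qed.

Lemma cutsumD f g s :
  cutsum (fun p r => f p r + g p r) s = cutsum f s + cutsum g s.
Proof. exact: big_split. Qed.

Lemma cutsumZ a f s : cutsum (fun p r => a * f p r) s = a * cutsum f s.
Proof. by rewrite [RHS]mulr_sumr. Qed.

Lemma cutsum_exchange (f : seq T -> seq T -> seq T -> seq T -> R) s r :
  cutsum (fun p q => cutsum (f p q) r) s =
  cutsum (fun p q => cutsum (fun p' q' => f p' q' p q) s) r.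
Proof. exact: exchange_big. Qed.

(** Both sides run over the ways to cut s in three. *)
Lemma cutsum_assoc (f : seq T -> seq T -> seq T -> R) s :
  cutsum (fun p r => cutsum (fun p1 p2 => f p1 p2 r) p) s =
  cutsum (fun p1 r => cutsum (fun p2 r' => f p1 p2 r') r) s.
Proof.
elim: s f => [|c s IH] f; first by rewrite !cutsum_nil.
rewrite !cutsum_cons cutsum_nil -IH -addrA; congr (_ + _).
by rewrite -cutsumD; apply: eq_cutsum => p r _; rewrite cutsum_cons.
Qed.

Lemma cutsum_cat_cons f s c p :
  cutsum f (s ++ c :: p) =
  cutsum (fun p1 p2 => f p1 (p2 ++ c :: p)) s +
  cutsum (fun p1 p2 => f (s ++ c :: p1) p2) p.
Proof.
elim: s f => [|d s IH] f /=; first by rewrite cutsum_cons cutsum_nil.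
by rewrite !cutsum_cons IH addrA.
Qed.

End Cuts.

Section CyclicDerivative.
Variables (K : fieldType) (Q : quiver).
Implicit Types (x y u W : pathser K Q) (a c : arrow Q) (v w : vertex Q).

Lemma coefM_cut x y v s :
  (x * y) v s = cutsum (fun p r => x v p * y (path_end v p) r) s.
Proof. by []. Qed.

Fact rquo_supp p x v s : ~~ is_path v s -> x v (s ++ p) = 0.
Proof. by move=> /negPf hs; rewrite coef_supp // is_path_cat hs. Qed.
Definition rquo p x := PathSer (@rquo_supp p x).

Lemma coef_rquo p x v s : rquo p x v s = x v (s ++ p). Proof. by []. Qed.

Fact rquo_linear p : linear (rquo p).
Proof. by move=> k x y; apply: pathserP => v s. Qed.
HB.instance Definition _ p :=
  GRing.isLinear.Build K (pathser K Q) (pathser K Q) _ (rquo p) (rquo_linear p).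

Fact insder_supp a W u v s : ~~ is_path v s ->
  (if v == head a then
     cutsum (fun p r => (u * rquo (a :: p) W) (path_end v p) r) s else 0) = 0.
Proof.
case: eqP => // -> hs; apply: big1 => k _.
move: hs; rewrite -{1}(cat_take_drop k s) is_path_cat negb_and => /orP[hp|hr].
  rewrite (_ : rquo _ W = 0) ?mulr0 //; apply: pathserP => w q /=.
  by rewrite coef_supp // is_path_cat is_path_cons (negPf hp) !andbF.
exact: coef_supp.
Qed.
(** For every occurrence of a in a word q a p of W, the cyclic derivative reads
    p q, starting after a and closing up the word; here u is written at the closing
    point, which yields p u q. Thus insder a W 1 is the cyclic derivative. Keeping
    track of u is what makes a Leibniz rule possible: the derivative of x in the
    product x y has the remaining factor y standing at the closing point. *)
Definition insder a W u := PathSer (@insder_supp a W u).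

Lemma coef_insder a W u v s : insder a W u v s =
  if v == head a then
    cutsum (fun p r => (u * rquo (a :: p) W) (path_end v p) r) s else 0.
Proof. by []. Qed.

Lemma insderE a W u s : insder a W u (head a) s =
  cutsum (fun p r => (u * rquo (a :: p) W) (path_end (head a) p) r) s.
Proof. by rewrite /= eqxx. Qed.

Lemma insder_ext a x y :
  (forall s, x (head a) s = y (head a) s) ->
  (forall v, v != head a -> x v =1 y v) -> x = y.
Proof.
move=> h1 h2; apply: pathserP => v s.
by case: (eqVneq v (head a)) => [->|/h2->].
Qed.

Fact insder_linearl a u : linear (fun W => insder a W u).
Proof.
move=> k x y; apply: (insder_ext (a := a)) => [s|v /negPf hv s]; last first.
  by rewrite coefD coefZ /= hv mulr0 addr0.
rewrite coefD coefZ !insderE -cutsumZ -cutsumD; apply: eq_cutsum => p r _.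
by rewrite linearP mulrDr -ser_scalerAr.
Qed.

Fact insder_linear a W : linear (insder a W).
Proof.
move=> k x y; apply: (insder_ext (a := a)) => [s|v /negPf hv s]; last first.
  by rewrite coefD coefZ /= hv mulr0 addr0.
rewrite coefD coefZ !insderE -cutsumZ -cutsumD; apply: eq_cutsum => p r _.
by rewrite mulrDl -ser_scalerAl.
Qed.
HB.instance Definition _ a W :=
  GRing.isLinear.Build K (pathser K Q) (pathser K Q) _ (insder a W) (insder_linear a W).

(** insder as a function of the potential, to carry its linearity. *)
Definition insder_of a u W := insder a W u.
HB.instance Definition _ a u :=
  GRing.isLinear.Build K (pathser K Q) (pathser K Q) _ (insder_of a u)
    (insder_linearl a u).

Lemma insderDl a x y u : insder a (x + y) u = insder a x u + insder a y u.
Proof. exact: (linearD (insder_of a u)). Qed.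

Lemma insderZl a k x u : insder a (k *: x) u = k *: insder a x u.
Proof. exact: (linearZ_LR (insder_of a u)). Qed.

Lemma insder0l a u : insder a 0 u = 0.
Proof. exact: (linear0 (insder_of a u)). Qed.

Lemma insder_suml a u (J : Type) (r : seq J) (P : pred J) (G : J -> pathser K Q) :
  insder a (\sum_(j <- r | P j) G j) u = \sum_(j <- r | P j) insder a (G j) u.
Proof. exact: (linear_sum (insder_of a u)). Qed.

Lemma insder_agree N a W u u' :
  agree N u u' -> agree N (insder a W u) (insder a W u').
Proof.
move=> uu v s sN; rewrite !coef_insder; case: eqP => // _; apply: eq_cutsum => p r sE.
by apply: (agreeMr (N := N) _ uu); apply: leq_ltn_trans sN; rewrite sE size_cat leq_addl.
Qed.

Lemma insder_agree0 N a W u : agree N u 0 -> agree N (insder a W u) 0.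
Proof. by move/(insder_agree a W); rewrite linear0. Qed.

(** Deleting the differentiated arrow costs one degree. *)
Lemma insder_agreel N a W W' u :
  agree N.+1 W W' -> agree N (insder a W u) (insder a W' u).
Proof.
move=> WW v s sN; rewrite !coef_insder; case: eqP => // _; apply: eq_cutsum => p r sE.
rewrite !coefM_cut; apply: eq_cutsum => m q rE /=; rewrite WW //.
by move: sN; rewrite sE rE !size_cat /=; lia.
Qed.

Lemma path_end_cat v (p q : seq (arrow Q)) :
  path_end v (p ++ q) = path_end (path_end v p) q.
Proof. by rewrite /path_end map_cat last_cat. Qed.

(** The word q a p of a product x y is cut either within q, so that a belongs to
    y, or within p = p1 p2, so that a belongs to x. *)
Lemma coef_mul_rquoM a p u x y v s :
  (u * rquo (a :: p) (x * y)) v s =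
  (u * x * rquo (a :: p) y) v s +
  cutsum (fun p1 p2 => y (path_end (head a) p1) p2 * (u * rquo (a :: p1) x) v s) p.
Proof.
rewrite -mulrA [in RHS]coefM_cut.
under [X in _ + X]eq_cutsum do rewrite coefM_cut -cutsumZ.
rewrite cutsum_exchange coefM_cut -cutsumD; apply: eq_cutsum => m q _.
rewrite coef_rquo coefM_cut cutsum_cat_cons mulrDr; congr (_ + _).
rewrite -cutsumZ; apply: eq_cutsum => p1 p2 _.
rewrite path_end_cat -[path_end _ (a :: p1)]/(path_end (head a) p1).
by rewrite [RHS]mulrCA coef_rquo; congr (_ * _); apply: mulrC.
Qed.

(** The cyclic Leibniz rule: when the occurrence of a lies in y, the closing point
    is followed by the factor x, and when it lies in x it is preceded by y. *)
Lemma insderM a x y u :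
  insder a (x * y) u = insder a y (u * x) + insder a x (y * u).
Proof.
apply: (insder_ext (a := a)) => [s|v /negPf hv s]; last first.
  by rewrite coefD /= hv addr0.
rewrite coefD !insderE.
under eq_cutsum do rewrite coef_mul_rquoM.
rewrite cutsumD; congr (_ + _).
pose G p1 p2 r := y (path_end (head a) p1) p2 *
  (u * rquo (a :: p1) x) (path_end (head a) (p1 ++ p2)) r.
transitivity (cutsum (fun p r => cutsum (fun p1 p2 => G p1 p2 r) p) s).
  by apply: eq_cutsum => p r _; apply: eq_cutsum => p1 p2 ->.
rewrite cutsum_assoc; apply: eq_cutsum => p r _.
rewrite -mulrA [RHS]coefM_cut; apply: eq_cutsum => p2 r' _.
by rewrite /G path_end_cat.
Qed.

Lemma insder_diag a W u :
  (forall v s, s != [::] -> W v s = 0) -> insder a W u = 0.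
Proof.
move=> W0; apply: (insder_ext (a := a)) => [s|v /negPf hv s]; last by rewrite /= hv.
rewrite insderE; apply: big1 => k _.
rewrite (_ : rquo _ W = 0) ?mulr0 //; apply: pathserP => v r /=.
by rewrite W0 // -size_eq0 size_cat addnS.
Qed.

Lemma insder_triv a v u : insder a (ser_triv K v) u = 0.
Proof. by apply: insder_diag => w s /negPf hs; rewrite /= hs !andbF. Qed.

Lemma insder_arrow a c u : insder a (ser_arrow K c) u =
  (c == a)%:R *: (ser_triv K (head a) * u * ser_triv K (tail a)).
Proof.
have nil_catP q p : (q ++ a :: p == [::]) = false by case: q.
have E : rquo [:: a] (ser_arrow K c) = (c == a)%:R *: ser_triv K (tail a).
  apply: pathserP => v [|d s]; rewrite coefZ /= eqseq_cons /= ?nil_catP ?andbF ?mulr0 //.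
  rewrite eqxx !andbT (eq_sym a) andbC; case: (eqVneq c a) => [->|_].
    by rewrite !andbT mul1r.
  by rewrite andbF mul0r.
have E' p : p != [::] -> rquo (a :: p) (ser_arrow K c) = 0.
  by case: p => // b p _; apply: pathserP => v [|d s];
     rewrite /= eqseq_cons /= ?nil_catP ?andbF.
apply: (insder_ext (a := a)) => [s|v hv s]; rewrite coefZ; last first.
  by rewrite -mulrA coef_trivM /= (negPf hv) mul0r mulr0.
rewrite insderE /cutsum big_ord_recl take0 drop0 E big1 => [|k _]; last first.
  rewrite E' ?mulr0 // -size_eq0 size_take lift0.
  by case: ifP => // _; case: s k => [[]|].
rewrite addr0 -ser_scalerAr coefZ -mulrA coef_trivM eqxx mul1r; congr (_ * _).
Qed.

(** A word q a p that is a path from the end of p is automatically closed; this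
    reconciles the cyclicity condition in cycder with the starting vertex used in
    insder. *)
Lemma coef_cyclic a W p q (hd := tail (seq.head a q)) :
  (if cycle (@composable Q) (q ++ a :: p) then W hd (q ++ a :: p) else 0) =
  W (path_end (head a) p) (q ++ a :: p).
Proof.
have E : path_end (head a) p = head (last (seq.head a q) (behead (q ++ a :: p))).
  by rewrite /path_end last_map; case: q @hd => [|b q] _ //=; rewrite last_cat.
have -> : q ++ a :: p = seq.head a q :: behead (q ++ a :: p) by case: q @hd E.
rewrite /= rcons_path [X in _ && X]/composable -E -/hd.
have [Ehd|/eqP Nhd] := eqVneq hd (path_end (head a) p).
  rewrite Ehd andbT; case: ifP => // /negbT h; rewrite coef_supp // /is_path.
  by rewrite (negPf h) andbF.
rewrite andbF coef_supp // /is_path.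
by case: eqP => // /esym.
Qed.

(** Cutting s as p r corresponds to the rotation of a s that starts with r. *)
Lemma insder1 a W : insder a W 1 = cycder a W.
Proof.
apply: (insder_ext (a := a)) => [s|v /negPf hv s]; last first.
  by rewrite /= /cycder_coef hv.
rewrite insderE [RHS]/= /cycder_coef eqxx (exchange_big_dep predT) //.
rewrite [RHS](reindex_inj rev_ord_inj); apply: eq_bigr => k _.
rewrite mul1r coef_rquo -coef_cyclic.
have wE : drop k s ++ a :: take k s = rotr (size s - k) (a :: s).
  rewrite /rotr /= subSn ?leq_subr // subKn -1?ltnS ?ltn_ord //.
pose c0 : (size s).+1.-tuple (arrow Q) := rotr_tuple (size s - k) (in_tuple (a :: s)).
have c0E (c : (size s).+1.-tuple (arrow Q)) : (rot (size s - k) c == a :: s) = (c == c0).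
  apply/eqP/eqP => [E|->]; last exact: rotrK.
  by apply: val_inj; rewrite /= -E rotK.
under eq_bigl do rewrite /= subSS c0E.
have cE : tval c0 = drop k s ++ a :: take k s by rewrite wE.
rewrite big_mkcondl big_pred1_eq cE; case: ifP => // _.
by rewrite /thead (tnth_nth a) cE; case: (drop k s).
Qed.

Lemma insder_trivMl a x u w :
  insder a (ser_triv K w * x) u = insder a x (u * ser_triv K w).
Proof. by rewrite insderM insder_triv addr0. Qed.

Lemma insder_trivMr a x u w :
  insder a (x * ser_triv K w) u = insder a x (ser_triv K w * u).
Proof. by rewrite insderM insder_triv add0r. Qed.

Lemma cycderD a x y : cycder a (x + y) = cycder a x + cycder a y.
Proof. by rewrite -!insder1 insderDl. Qed.

Lemma cycderZ a k x : cycder a (k *: x) = k *: cycder a x.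
Proof. by rewrite -!insder1 insderZl. Qed.

Lemma cycder_sum a (J : Type) (r : seq J) (P : pred J) (G : J -> pathser K Q) :
  cycder a (\sum_(j <- r | P j) G j) = \sum_(j <- r | P j) cycder a (G j).
Proof.
by rewrite -insder1 insder_suml; apply: eq_bigr => j _; rewrite insder1.
Qed.

Lemma cycderM a x y : cycder a (x * y) = insder a y x + insder a x y.
Proof. by rewrite -insder1 insderM mul1r mulr1. Qed.

Lemma cycderMC a x y : cycder a (x * y) = cycder a (y * x).
Proof. by rewrite !cycderM addrC. Qed.

Lemma coef_Mtriv x w v s : (x * ser_triv K w) v s = (path_end v s == w)%:R * x v s.
Proof.
rewrite coefM big_ord_recr /= take_size drop_size big1 ?add0r => [|k _].
  by rewrite andbT mulrC.
rewrite -size_eq0 size_drop subn_eq0 leqNgt ltn_ord /= andbF; exact: mulr0.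
Qed.

Lemma cycder_ends a W :
  ser_triv K (head a) * cycder a W * ser_triv K (tail a) = cycder a W.
Proof.
apply: pathserP => v s; rewrite coef_Mtriv coef_trivM -insder1.
case: (eqVneq v (head a)) => [->|/negPf hv]; last by rewrite /= hv !mulr0.
rewrite mul1r; case: eqP => [_|hs]; first by rewrite mul1r.
rewrite mul0r insderE; apply/esym/big1 => k _; rewrite mul1r coef_rquo coef_supp //.
rewrite is_path_cat is_path_cons -path_end_cat cat_take_drop.
by rewrite [tail a == _]eq_sym; move/eqP/negPf: hs => ->; rewrite andbF.
Qed.

Lemma insder_powsum0 a k x u : (forall v, x v [::] = 0) ->
  (forall u, insder a x u = 0) -> insder a (powsum k x) u = 0.
Proof.
move=> x0 ax0; have aX0 j y : insder a (x ^+ j) y = 0.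
  elim: j y => [|j IH] y; last by rewrite exprS insderM IH ax0 addr0.
  by rewrite expr0 insder_diag // => v s /negPf hs; rewrite coef1 hs.
apply: agree_eq => N; have := powsum_agree k x0 (leqnn N.+1).
move/(insder_agreel a u) => h; apply: agree_trans h _.
rewrite insder_suml big1 // => j _; by rewrite insderZl aX0 scaler0.
Qed.

End CyclicDerivative.

Section ChainRule.
Variables (K : fieldType) (V A A' : finType).
Variables (t h : A -> V) (t' h' : A' -> V).
Let Q := Quiver t h.
Let Q' := Quiver t' h'.
Variable F : substitution K t h t' h'.

(** The occurrences of d are those after the first arrow, and the first arrow
    itself. *)
Lemma insder_decomp (d : arrow Q) (W u : pathser K Q) :
  insder d W u =
  \sum_(c : arrow Q) insder d (lquo c W) (u * ser_arrow K c) +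
  ser_triv K (head d) * (lquo d W * u) * ser_triv K (tail d).
Proof.
rewrite {1}[W]series_decomp insderDl insder_suml.
rewrite (@insder_diag _ _ d (diag _ _ W)) ?add0r => [|v []] //.
under eq_bigr do rewrite insderM insder_arrow.
rewrite big_split /=; congr (_ + _).
rewrite (bigD1 d) //= eqxx scale1r big1 ?addr0 // => c /negPf cd.
by rewrite cd scale0r.
Qed.

(** The chain rule: an occurrence of a in the substituted potential lies in the
    image of one letter c, and what surrounds this image is the substitution of
    what surrounds c. Splitting off the first arrow of W moves it into u, so that
    the degree of u grows until u is negligible: the induction is on the
    difference between the precision M and the degree of u. *)
Lemma insder_subst (a : arrow Q') (W u : pathser K Q) :
  insder a (subst F W) (subst F u) =
  \sum_(c : arrow Q) insder a (F c) (subst F (insder c W u)).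
Proof.
apply: agree_eq => M.
suff: forall d (W u : pathser K Q), agree (M - d) u 0 ->
    agree M (insder a (subst F W) (subst F u))
      (\sum_(c : arrow Q) insder a (F c) (subst F (insder c W u))).
  by move/(_ M W u); apply; rewrite subnn.
elim=> [|d IH] {}W {}u u0.
  rewrite subn0 in u0; have Fu0 := subst_agree0 F u0.
  apply: agree_trans (insder_agree0 _ _ Fu0) _; apply: agree_sym.
  by apply: agree_sum0 => c _; apply/insder_agree0/subst_agree0/insder_agree0.
have -> : insder a (subst F W) (subst F u) = \sum_(c : arrow Q)
    insder a (subst F (lquo c W)) (subst F (u * ser_arrow K c)) +
    \sum_(c : arrow Q) insder a (F c) (subst F (lquo c W * u)).
  rewrite subst_rec insderDl insder_suml insder_diag ?add0r => [|v []] //.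
  by rewrite -big_split; apply: eq_bigr => c _; rewrite insderM -(subst_arrow F) -!rmorphM.
have -> : \sum_(c : arrow Q) insder a (F c) (subst F (insder c W u)) =
    \sum_(c : arrow Q) \sum_(b : arrow Q)
      insder a (F b) (subst F (insder b (lquo c W) (u * ser_arrow K c))) +
    \sum_(c : arrow Q) insder a (F c) (subst F (lquo c W * u)).
  rewrite exchange_big -big_split; apply: eq_bigr => c _ /=.
  rewrite insder_decomp !linearD !linear_sum; congr (_ + _).
  rewrite /= !rmorphM /= !subst_triv -insder_trivMl image_tail.
  by rewrite -insder_trivMr image_head.
apply: agreeD => //; apply: agree_sum => c _; apply: IH.
rewrite -[X in agree _ _ X](mul0r (ser_arrow K c)).
apply: (@agree_le _ _ _ (M - d.+1).+1); first by lia.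
by apply: agreeMr_lift => // v; apply: ser_arrow_const.
Qed.

End ChainRule.

(** * Morphisms of Jacobi algebras *)
Section JacobiIdeal.
Variables (K : fieldType) (Q : quiver) (W : pathser K Q).

Lemma jac_ideal_closed x :
  (forall N, exists2 y, y \in jac_ideal W & agree N x y) -> x \in jac_ideal W.
Proof.
move=> hx; apply/jac_idealP => N; have [y /jac_idealP/(_ N)[z Iz yz] xy] := hx N.
by exists z => //; apply: agree_trans xy yz.
Qed.

End JacobiIdeal.

Section JacobiMap.
Variables (K : fieldType) (V A A' : finType).
Variables (t h : A -> V) (t' h' : A' -> V).
Let Q := Quiver t h.
Let Q' := Quiver t' h'.
Variables (W : pathser K Q) (W' : pathser K Q') (F : substitution K t h t' h').
Hypothesis F_cycder : forall c : arrow Q, subst F (cycder c W) \in jac_ideal W'.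

Lemma subst_jac_ideal x : x \in jac_ideal W -> subst F x \in jac_ideal W'.
Proof.
move=> /jac_idealP hx; apply: jac_ideal_closed => N.
have [y [r hr ->] xy] := hx N; eexists; last exact: subst_agree F _ _ _ xy.
rewrite linear_sum big_seq; apply: rpred_sum => u /hr[a _ aE].
rewrite !rmorphM; apply/jac_idealMr/jac_idealMl.
by rewrite /= -aE F_cycder.
Qed.

Definition jac_map (u : Jac W) : Jac W' := toJac W' (subst F (repr u)).

Lemma jac_map_toJac x : jac_map (toJac W x) = toJac W' (subst F x).
Proof.
by apply/toJac_eq; rewrite -linearB subst_jac_ideal ?repr_toJac.
Qed.

Fact jac_map_zmod : zmod_morphism jac_map.
Proof.
move=> u v; rewrite -[u]toJacK -[v]toJacK -raddfB !jac_map_toJac.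
by rewrite linearB raddfB.
Qed.

Fact jac_map_monoid : monoid_morphism jac_map.
Proof.
split=> [|u v]; first by rewrite -(rmorph1 (toJac W)) jac_map_toJac !rmorph1.
by rewrite -[u]toJacK -[v]toJacK -rmorphM !jac_map_toJac !rmorphM.
Qed.

Lemma jac_map_scalable : scalable jac_map.
Proof.
move=> k u; rewrite -[u]toJacK -[k *: _](linearZ_LR (toJac W)) !jac_map_toJac.
by rewrite (linearZ_LR (subst F)) (linearZ_LR (toJac W')).
Qed.

Definition jac_rmorphism : {rmorphism Jac W -> Jac W'} :=
  HB.pack_for {rmorphism Jac W -> Jac W'} jac_map
    (GRing.isZmodMorphism.Build (Jac W) (Jac W') jac_map jac_map_zmod)
    (GRing.isMonoidMorphism.Build (Jac W) (Jac W') jac_map jac_map_monoid).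

End JacobiMap.

Section JacobiIsomorphism.
Variables (K : fieldType) (V A A' : finType).
Variables (t h : A -> V) (t' h' : A' -> V).
Let Q := Quiver t h.
Let Q' := Quiver t' h'.
Variables (W : pathser K Q) (W' : pathser K Q').
Variables (F : substitution K t h t' h') (G : substitution K t' h' t h).

(** A retraction criterion: F is onto by the third condition. The second and the
    fourth give that G maps derivatives of W' into the Jacobi ideal of W, since
    G (F x) is congruent to x there for every series x. *)
Theorem jac_iso_subst :
  (forall c : arrow Q, subst F (cycder c W) \in jac_ideal W') ->
  (forall c' : arrow Q', exists c : arrow Q, cycder c' W' = subst F (cycder c W)) ->
  (forall c : arrow Q', subst F (G c) = ser_arrow K c) ->
  (forall c : arrow Q, subst G (F c) - ser_arrow K c \in jac_ideal W) ->
  jac_iso W W'.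
Proof.
move=> hF hW' FG GF.
have GFx x : subst G (subst F x) - x \in jac_ideal W.
  rewrite subst_compE -[X in _ - X]subst_idE.
  apply: (@subst_congr _ _ _ _ _ _ _ _ _ _ (fun x => x \in jac_ideal W)) => //.
  - exact: rpred0.
  - by move=> {}x y; apply: rpredD.
  - by move=> {}x y; apply: jac_idealMr.
  - by move=> {}x y; apply: jac_idealMl.
  - exact: jac_ideal_closed.
have hG (c : arrow Q') : subst G (cycder c W') \in jac_ideal W.
  have [b ->] := hW' c.
  by rewrite -(subrK (cycder b W) (subst G _)) rpredD ?jac_ideal_cycder.
exists (jac_rmorphism hF); split; first exact: jac_map_scalable.
exists (jac_map W G) => u; rewrite -[u]toJacK /= !jac_map_toJac //; apply/toJac_eq => //.
rewrite subst_compE -[X in _ - X]subst_idE.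
rewrite (_ : _ - _ = 0) ?rpred0 //.
apply: (@subst_congr _ _ _ _ _ _ _ _ _ _ (fun x => x = 0)) => //.
- by move=> x y -> ->; rewrite addr0.
- by move=> x y ->; rewrite mul0r.
- by move=> x y ->; rewrite mulr0.
- by move=> x hx; apply: agree_eq => N; have [_ ->] := hx N.
- by move=> c /=; rewrite FG subrr.
Qed.

End JacobiIsomorphism.

(** * Type A potentials as sums over the vertices *)
Section PowerSums.
Variables (K : fieldType) (Q : quiver).
Implicit Types (x : pathser K Q) (k : nat -> K).

Lemma powsum0 k : powsum k (0 : pathser K Q) = 0.
Proof.
apply: pathserP => v s; rewrite coef0 /= /powsum_coef big_nat_cond big1 // => j.
by case/andP=> /andP[j2 _] _; rewrite expr0n gtn_eqF ?coef0 ?mulr0 // ltnW.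
Qed.

Lemma powsumD k k' x : powsum (fun j => k j + k' j) x = powsum k x + powsum k' x.
Proof.
apply: pathserP => v s; rewrite coefD /= /powsum_coef -big_split.
by apply: eq_bigr => j _; rewrite mulrDl.
Qed.

Lemma powsum_square (c : K) x : (forall v, x v [::] = 0) ->
  powsum (fun j => if j == 2 then c else 0) x = c *: x ^+ 2.
Proof.
move=> x0; apply: agree_eq => N.
apply: agree_trans (powsum_agree _ x0 (leq_trans (leqnSn N) (leqnSn N.+1))) _.
rewrite big_ltn //= big_nat_cond big1 ?addr0 // => j /andP[/andP[j2 _] _].
by rewrite gtn_eqF // scale0r.
Qed.

End PowerSums.

Section VertexForm.
Variables (n : nat) (I : {set 'I_n}) (K : fieldType).
Notation Q := (typeA_quiver I).
Notation S := (pathser K Q).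

(** These are x and x' of the pair j, loops at its left and at its right vertex. *)
Definition round_lo (j : 'I_n.-1) : S := mem_a K (Pair I j) * mem_b K (Pair I j).
Definition round_hi (j : 'I_n.-1) : S := mem_b K (Pair I j) * mem_a K (Pair I j).

(** The default value 0, when the loop or the neighbour does not exist, makes the formulas below uniform in
    the vertex, the two ends of the quiver included. *)
Definition loop_at (i : 'I_n) : S :=
  if insub i is Some l then ser_arrow K (loop l : arrow Q) else 0.
Definition right_at (k : nat) : S := if insub k is Some j then round_lo j else 0.
Definition left_at (k : nat) : S :=
  if k is k'.+1 then (if insub k' is Some j then round_hi j else 0) else 0.

(** The coefficients are indexed by positions in the list of members; the members
    at the vertex k start after this position. *)
Definition offset (k : nat) : nat :=
  \sum_(i < n | (i < k)%N) ((i \notin I) + (i < n.-1))%N.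

Lemma offset0 : offset 0 = 0%N.
Proof. by apply: big_pred0. Qed.

Lemma offsetS (i : 'I_n) : offset i.+1 = (offset i + ((i \notin I) + (i < n.-1)))%N.
Proof.
rewrite /offset (bigD1 i) ?ltnSn //= addnC; congr (_ + _)%N.
by apply: eq_bigl => j; rewrite ltnS -(inj_eq val_inj) ltn_neqAle andbC.
Qed.

(** What the members at i contribute to the potential: their powers, and the links
    that join them to each other and to the preceding member. *)
Definition vertex_term (kappa : nat -> nat -> K) (i : 'I_n) : S :=
  (if i \in I then left_at i * right_at i
   else left_at i * loop_at i + loop_at i * right_at i) +
  powsum (kappa (offset i).+1) (loop_at i) +
  powsum (kappa (offset i + (i \notin I)).+1) (right_at i).

Let X (e : member I) : S := mem_a K e * mem_b K e.
Let X' (e : member I) : S := mem_b K e * mem_a K e.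

Lemma XLoop l : X (Loop l) = ser_arrow K (loop l : arrow Q).
Proof. exact: ser_arrow_triv. Qed.
Lemma XPair j : X (Pair I j) = round_lo j. Proof. by []. Qed.
Lemma X'Pair j : X' (Pair I j) = round_hi j. Proof. by []. Qed.
Lemma X'Loop l : X' (Loop l) = ser_arrow K (loop l : arrow Q).
Proof. exact: (@triv_arrow K Q (loop l)). Qed.

(** The contribution of a final part L of the list of members, where o is the
    number of its first member and p is x' of the member before it. *)
Fixpoint chain (kappa : nat -> nat -> K) (p : S) (o : nat) (L : seq (member I)) : S :=
  if L is e :: L' then
    p * X e + powsum (kappa o) (X e) + chain kappa (X' e) o.+1 L'
  else 0.

Lemma chainE kappa p o L : chain kappa p o L =
  p * nth 0 (map X L) 0 +
  \sum_(0 <= i < (size L).-1) nth 0 (map X' L) i * nth 0 (map X L) i.+1 +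
  \sum_(0 <= i < size L) powsum (kappa (o + i)%N) (nth 0 (map X L) i).
Proof.
elim: L p o => [|e L IH] p o; first by rewrite /= !big_geq // mulr0 !addr0.
rewrite /= IH [in RHS](big_nat_recl (size L)) //= addn0.
have -> : \sum_(0 <= i < size L) powsum (kappa (o.+1 + i)%N) (nth 0 (map X L) i) =
    \sum_(0 <= i < size L) powsum (kappa (o + i.+1)%N) (nth 0 (map X L) i).
  by apply: eq_bigr => i _; rewrite addSnnS.
set A := p * X e; set B := powsum _ (X e); set D := \sum_(0 <= i < size L) powsum _ _.
rewrite -!addrA; congr (_ + _); rewrite [RHS]addrCA; congr (_ + _).
rewrite addrA; congr (_ + _).
case: L {IH D} => [|e' L] /=; first by rewrite !big_geq // mulr0 addr0.
by rewrite [RHS]big_nat_recl.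
Qed.

Lemma monomialized_chain kappa : monomialized I kappa = chain kappa 0 1 (members I).
Proof.
rewrite chainE mul0r add0r /monomialized -size_members; congr (_ + _).
  by rewrite big_add1.
by rewrite big_add1.
Qed.

(** After the last vertex there are no members left, so the second alternative only
    serves to state the step for an arbitrary continuation L. *)
Lemma chain_block kappa (i : 'I_n) L :
  chain kappa (left_at i) (offset i).+1 (members_at I i ++ L) =
  vertex_term kappa i +
  if (i < n.-1)%N then chain kappa (left_at i.+1) (offset i.+1).+1 L
  else chain kappa (if i \in I then left_at i else loop_at i) (offset i.+1).+1 L.
Proof.
rewrite offsetS /vertex_term /members_at /loop_at /right_at /left_at -/(left_at i).
case: insubP => [l il _|il]; case: insubP => [j jn ji|/negPf jn].
- rewrite (jn : (i < n.-1)%N = true) il (negPf il) /= XLoop X'Loop XPair X'Pair.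
  rewrite addn1 addn2 -!addrA; congr (_ + _).
  by rewrite [RHS]addrCA.
- rewrite (jn : (i < n.-1)%N = false) il (negPf il) /= XLoop X'Loop addn0 addn1.
  by rewrite powsum0 mulr0 !addr0.
- rewrite negbK in il; rewrite (jn : (i < n.-1)%N = true) il /= XPair X'Pair addn0 add0n addn1.
  by rewrite powsum0 !addr0.
- rewrite negbK in il; rewrite (jn : (i < n.-1)%N = false) il /= addn0.
  by rewrite !powsum0 mulr0 !addr0 add0r.
Qed.

Lemma monomialized_vertex kappa : monomialized I kappa = \sum_i vertex_term kappa i.
Proof.
rewrite monomialized_chain /members -big_enum /=.
(* The continuations of the list are indexed by consecutive vertices. *)
suff gen (s : seq 'I_n) k : [seq val i | i <- s] = iota k (n - k) ->
    chain kappa (left_at k) (offset k).+1 (flatten [seq members_at I i | i <- s]) =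
    \sum_(i <- s) vertex_term kappa i.
  by move: (gen (enum 'I_n) 0%N); rewrite offset0 val_enum_ord subn0 => ->.
elim: s k => [|i s IH] k sE; first by rewrite big_nil.
have [ik sE'] : val i = k /\ [seq val i | i <- s] = iota k.+1 (n - k.+1).
  by move: sE; case E: (n - k)%N => [|m] //= [-> ->]; split=> //; congr iota; lia.
rewrite /= -ik chain_block big_cons; congr (_ + _).
rewrite -(IH (val i).+1) ?ik //; case: ifP => // kn.
suff -> : s = [::] by [].
apply/nilP; rewrite /nilp -(size_map val) sE' size_iota subn_eq0.
by have ik' : nat_of_ord i = k := ik; move: kn => /=; lia.
Qed.
End VertexForm.

(** * Elimination of the loops at the vertices of I *)
Section RoundTrips.
Variables (n : nat) (I : {set 'I_n}) (K : fieldType).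
Notation Q := (typeA_quiver I).
Notation S := (pathser K Q).

Lemma round_lo_const j v : round_lo I K j v [::] = 0.
Proof. by rewrite [LHS]conv_nil ser_arrow_const mul0r. Qed.

Lemma round_hi_const j v : round_hi I K j v [::] = 0.
Proof. by rewrite [LHS]conv_nil ser_arrow_const mul0r. Qed.

Lemma right_at_const k v : right_at I K k v [::] = 0.
Proof. by rewrite /right_at; case: insub => // j; apply: round_lo_const. Qed.

Lemma left_at_const k v : left_at I K k v [::] = 0.
Proof. by case: k => //= k; case: insub => // j; apply: round_hi_const. Qed.

Lemma loop_at_const i v : loop_at I K i v [::] = 0.
Proof. by rewrite /loop_at; case: insub => // l; apply: ser_arrow_const. Qed.

Lemma right_at_ends (i : 'I_n) :
  ser_triv K (i : vertex Q) * right_at I K i * ser_triv K (i : vertex Q) = right_at I K i.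
Proof.
rewrite /right_at; case: insubP => [j _ ji|_]; last by rewrite mulr0 mul0r.
have -> : i = pair_lo j by apply: val_inj.
rewrite /round_lo /= mulrA (@triv_arrow K Q (fwd I j)) -mulrA.
by rewrite (@ser_arrow_triv K Q (bwd I j)).
Qed.

Lemma left_at_ends (i : 'I_n) :
  ser_triv K (i : vertex Q) * left_at I K i * ser_triv K (i : vertex Q) = left_at I K i.
Proof.
case: i => -[|k] kn; first by rewrite /= mulr0 mul0r.
rewrite /=; case: insubP => [j _ ji|_]; last by rewrite mulr0 mul0r.
have -> : Ordinal kn = pair_hi j by apply: val_inj; rewrite /= -ji.
rewrite /round_hi /= mulrA (@triv_arrow K Q (bwd I j)) -mulrA.
by rewrite (@ser_arrow_triv K Q (fwd I j)).
Qed.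

Lemma loop_at_ends (i : 'I_n) :
  ser_triv K (i : vertex Q) * loop_at I K i * ser_triv K (i : vertex Q) = loop_at I K i.
Proof.
rewrite /loop_at; case: insubP => [l _ <-|_]; last by rewrite mulr0 mul0r.
exact: (@arrow_ends K Q (loop l)).
Qed.

(** (b a)(b a) and (a b)(a b) are cyclic rotations of each other. *)
Lemma cycder_round_square (a : arrow Q) k :
  cycder a (left_at I K k.+1 ^+ 2) = cycder a (right_at I K k ^+ 2).
Proof.
rewrite /left_at /right_at; case: insub => // j.
by rewrite !expr2 /round_lo /round_hi -mulrA cycderMC !mulrA.
Qed.

End RoundTrips.

(** Substitutions that fix the arrows of the pairs preserve the round trips. *)
Section FixedPairs.
Variables (n : nat) (I J : {set 'I_n}) (K : fieldType).
Variable T : substitution K (@typeA_tail n I) (@typeA_head n I)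
  (@typeA_tail n J) (@typeA_head n J).
Hypothesis T_fwd : forall j, T (fwd I j) = ser_arrow K (fwd J j : arrow (typeA_quiver J)).
Hypothesis T_bwd : forall j, T (bwd I j) = ser_arrow K (bwd J j : arrow (typeA_quiver J)).

Lemma subst_right_at k : subst T (right_at I K k) = right_at J K k.
Proof.
rewrite /right_at; case: insub => [j|]; last by rewrite linear0.
by rewrite rmorphM /= !subst_arrow T_fwd T_bwd.
Qed.

Lemma subst_left_at k : subst T (left_at I K k) = left_at J K k.
Proof.
case: k => [|k] /=; first by rewrite linear0.
by case: insub => [j|]; rewrite ?linear0 // rmorphM /= !subst_arrow T_fwd T_bwd.
Qed.

End FixedPairs.

Lemma sum_shift (U : zmodType) m (G H : nat -> U) :
  G 0%N = 0 -> (forall k, G k.+1 = H k) -> H m.-1 = 0 ->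
  \sum_(i < m) G i = \sum_(i < m) H i.
Proof.
case: m => [|m] G0 GH Hm; first by rewrite !big_ord0.
rewrite big_ord_recl big_ord_recr /= G0 Hm add0r addr0.
by apply: eq_bigr => i _; apply: GH.
Qed.

Section LoopElimination.
Variables (n : nat) (I : {set 'I_n}) (K : fieldType) (kappa' : nat -> nat -> K).
Hypothesis two_neq0 : 2%:R != 0 :> K.
Local Notation full := (@finset.set0 'I_n).
Notation Q0 := (typeA_quiver full).
Notation Q := (typeA_quiver I).
Notation S0 := (pathser K Q0).
Notation S := (pathser K Q).

Fact full_loop_subproof (i : 'I_n) : i \notin full.
Proof. by rewrite finset.in_set0. Qed.
Definition full_loop (i : 'I_n) : arrow Q0 := loop (Sub i (full_loop_subproof i)).

Lemma loop_at_full i : loop_at full K i = ser_arrow K (full_loop i).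
Proof. 
rewrite /loop_at insubT ?full_loop_subproof // => h; congr (ser_arrow K _).
by congr inr; apply: val_inj.
Qed.

Definition loop_image (i : 'I_n) : S :=
  if i \in I then left_at I K i + right_at I K i else loop_at I K i.

Definition elim_image (c : typeA_arrow full) : S :=
  match c with
  | inl (inl j) => ser_arrow K (fwd I j : arrow Q)
  | inl (inr j) => ser_arrow K (bwd I j : arrow Q)
  | inr l => loop_image (val l)
  end.

Fact elim_const0 c (v : 'I_n) : elim_image c v [::] = 0.
Proof.
case: c => [[j|j]|l]; rewrite /elim_image; try exact: ser_arrow_const.
rewrite /loop_image; case: ifP => _; last exact: loop_at_const.
by rewrite coefD left_at_const right_at_const addr0.
Qed.

Fact elim_ends c :
  ser_triv K (typeA_tail c : vertex Q) * elim_image c *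
    ser_triv K (typeA_head c : vertex Q) = elim_image c.
Proof.
case: c => [[j|j]|l]; rewrite /elim_image.
- exact: (@arrow_ends K Q (fwd I j)).
- exact: (@arrow_ends K Q (bwd I j)).
rewrite /loop_image /=; case: ifP => _; last exact: loop_at_ends.
by rewrite mulrDr mulrDl left_at_ends right_at_ends.
Qed.

Definition elim : substitution K (@typeA_tail n full) (@typeA_head n full)
    (@typeA_tail n I) (@typeA_head n I) :=
  Substitution elim_const0 elim_ends.

Definition incl_arrow (c : typeA_arrow I) : typeA_arrow full :=
  match c with
  | inl (inl j) => fwd full j
  | inl (inr j) => bwd full j
  | inr l => full_loop (val l)
  end.

Fact incl_ends c :
  ser_triv K (typeA_tail c : vertex Q0) * ser_arrow K (incl_arrow c : arrow Q0) *
    ser_triv K (typeA_head c : vertex Q0) = ser_arrow K (incl_arrow c : arrow Q0).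
Proof.
have := @arrow_ends K Q0 (incl_arrow c).
by case: c => [[j|j]|l].
Qed.

Definition incl : substitution K (@typeA_tail n I) (@typeA_head n I)
    (@typeA_tail n full) (@typeA_head n full) :=
  Substitution (fun c => @ser_arrow_const K Q0 (incl_arrow c)) incl_ends.

Lemma elim_incl_arrow c : elim (incl_arrow c) = ser_arrow K (c : arrow Q).
Proof.
case: c => [[j|j]|l] //=; rewrite /loop_image (negPf (valP l)) /loop_at.
by rewrite valK.
Qed.

Variant full_arrow_spec : typeA_arrow full -> Prop :=
| FullLoop i of i \in I : full_arrow_spec (full_loop i)
| FullIncl c : full_arrow_spec (incl_arrow c).

Lemma full_arrowP c : full_arrow_spec c.
Proof.
case: c => [[j|j]|l].
- exact: (FullIncl (fwd I j)).
- exact: (FullIncl (bwd I j)).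
have [lI|lI] := boolP (val l \in I).
  have -> : inr l = full_loop (val l) :> typeA_arrow full by congr inr; apply: val_inj.
  exact: FullLoop.
have -> : inr l = incl_arrow (inr (Sub (val l) lI)) :> typeA_arrow full.
  by congr inr; apply: val_inj.
exact: FullIncl.
Qed.

Lemma incl_arrow_inj : injective incl_arrow.
Proof.
move=> [[j|j]|l] [[j'|j']|l'] //= [].
- by move->.
- by move->.
- by move=> e; congr inr; apply: val_inj.
Qed.

Lemma subst_elim_right k : subst elim (right_at full K k) = right_at I K k.
Proof. exact: subst_right_at. Qed.

Lemma subst_elim_left k : subst elim (left_at full K k) = left_at I K k.
Proof. exact: subst_left_at. Qed.

Lemma subst_elim_loop i : subst elim (loop_at full K i) = loop_image i.
Proof. by rewrite loop_at_full subst_arrow. Qed.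

(** Membership in I on natural numbers, false beyond the last vertex, so that the
    right neighbour of any vertex can be tested. *)
Definition inI (k : nat) : bool := [exists i in I, val i == k].

Lemma inIE (i : 'I_n) : inI i = (i \in I).
Proof.
apply/existsP/idP => [[j /andP[jI /eqP/val_inj <-]] //|iI].
by exists i; rewrite iI /=.
Qed.

(** The coefficient - 1/2 makes the derivative by an eliminated loop c equal to
    L + R - c; the corrections in pair_kappa cancel the squares L^2 / 2 and
    R^2 / 2 that the substitution of L + R creates at the two ends of the pair. *)
Definition loop_kappa (k : nat) : nat -> K :=
  if inI k then fun j => if j == 2 then - 2%:R^-1 else 0
  else kappa' (offset I k).+1.

Definition pair_kappa (k j : nat) : K :=
  kappa' (offset I k + ~~ inI k).+1 j +
  (if j == 2 then - (2%:R^-1 * ((inI k)%:R + (inI k.+1)%:R)) else 0).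

(** In the full quiver the member 2i+1 is the loop at the vertex i, counted from
    0, and the member 2i+2 is the pair on its right. *)
Definition full_kappa (k : nat) : nat -> K :=
  if odd k then loop_kappa k./2 else pair_kappa (k./2).-1.

Definition full_term (i : 'I_n) : S0 :=
  left_at full K i * loop_at full K i + loop_at full K i * right_at full K i +
  powsum (loop_kappa i) (loop_at full K i) +
  powsum (pair_kappa i) (right_at full K i).

Lemma offset_full k : (k < n)%N -> offset full k = (2 * k)%N.
Proof.
elim: k => [|k IH] kn; first by rewrite offset0.
have := offsetS full (Ordinal (ltnW kn)).
rewrite finset.in_set0 [nat_of_ord _]/= => ->.
rewrite /= (IH (ltnW kn)) (_ : (k < n.-1)%N); last by lia.
by rewrite mulnS addnC.
Qed.

Lemma full_potential : monomialized full full_kappa = \sum_i full_term i.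
Proof.
rewrite monomialized_vertex; apply: eq_bigr => i _.
rewrite /vertex_term finset.in_set0 offset_full // /full_term /full_kappa /=.
rewrite addn1 /= mul2n odd_double /= uphalf_double; congr (_ + powsum _ _ + powsum _ _).
  by rewrite doubleK.
Qed.

Section LoopDerivative.
Variable (i : 'I_n).
Hypothesis iI : i \in I.

Lemma insder_full_right k u : insder (full_loop i) (right_at full K k) u = 0.
Proof.
rewrite /right_at; case: insub => [j|]; last exact: insder0l.
by rewrite insderM !insder_arrow !scale0r addr0.
Qed.

Lemma insder_full_left k u : insder (full_loop i) (left_at full K k) u = 0.
Proof.
case: k => [|k] /=; first exact: insder0l.
case: insub => [j|]; last exact: insder0l.
by rewrite insderM !insder_arrow !scale0r addr0.
Qed.

Lemma insder_full_loop j u : insder (full_loop i) (loop_at full K j) u =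
  (j == i)%:R *: (ser_triv K (i : vertex Q0) * u * ser_triv K (i : vertex Q0)).
Proof.
by rewrite loop_at_full insder_arrow; congr (_%:R *: _).
Qed.

Lemma cycder_full_loop :
  cycder (full_loop i) (monomialized full full_kappa) =
  left_at full K i + right_at full K i - loop_at full K i.
Proof.
rewrite full_potential cycder_sum (bigD1 i) //= big1 ?addr0 => [|j /negPf ji].
  rewrite !cycderD !cycderM insder_full_left insder_full_right !insder_full_loop.
  rewrite -[cycder _ (powsum (pair_kappa _) _)]insder1 insder_powsum0 ?addr0;
    [|exact: right_at_const|exact: insder_full_right].
  rewrite eqxx !scale1r left_at_ends right_at_ends add0r; congr (_ + _).
  rewrite /loop_kappa inIE iI powsum_square; last exact: loop_at_const.
  rewrite cycderZ expr2 cycderM insder_full_loop eqxx scale1r loop_at_ends.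
  by rewrite -mulr2n -scaler_nat scalerA mulNr mulVf // scaleN1r.
rewrite !cycderD !cycderM insder_full_left insder_full_right !insder_full_loop ji.
rewrite !scale0r !addr0 add0r -!insder1 !insder_powsum0 ?addr0 //.
- exact: right_at_const.
- exact: insder_full_right.
- exact: loop_at_const.
- by move=> u; rewrite insder_full_loop ji scale0r.
Qed.

End LoopDerivative.

(** At a vertex of I the substitution leaves L^2 / 2 and R^2 / 2 in excess, up to
    rotation. The correction in pair_kappa subtracts R^2 / 2 once for each end of
    the pair that lies in I. *)
Lemma cycder_elim_term (a : arrow Q) i :
  cycder a (subst elim (full_term i)) =
  cycder a (vertex_term I kappa' i) +
  2%:R^-1 *: ((inI i)%:R *: cycder a (left_at I K i ^+ 2) -
              (inI i.+1)%:R *: cycder a (right_at I K i ^+ 2)).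
Proof.
rewrite /full_term !linearD /= !rmorphM /= !subst_powsum;
  [|exact: right_at_const|exact: loop_at_const].
rewrite subst_elim_left subst_elim_loop subst_elim_right /vertex_term.
rewrite /pair_kappa powsumD powsum_square; last exact: right_at_const.
rewrite /loop_image /loop_kappa inIE.
set L := left_at I K i; set R := right_at I K i.
case: ifP => iI; last first.
  rewrite /= !cycderD !cycderZ addn1.
  apply: pathserP => v s; rewrite !(coefD, coefN, coefZ) /=.
  by ring.
have -> : loop_at I K i = 0 by rewrite /loop_at insubF // iI.
rewrite powsum_square => [|v]; last by rewrite coefD left_at_const right_at_const addr0.
rewrite powsum0 /= addr0 addn0 !expr2 !mulrDl !mulrDr !cycderD !cycderZ !cycderD.
rewrite (cycderMC a R L).
apply: pathserP => v s; rewrite !(coefD, coefN, coefZ) /=.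
by field.
Qed.

(** The excesses cancel in the sum over the vertices, because L^2 at i+1 and R^2
    at i have the same cyclic derivatives. *)
Lemma cycder_elim (a : arrow Q) :
  cycder a (subst elim (monomialized full full_kappa)) =
  cycder a (monomialized I kappa').
Proof.
rewrite full_potential monomialized_vertex linear_sum !cycder_sum.
under eq_bigr do rewrite cycder_elim_term.
rewrite big_split -scaler_sumr sumrB /=.
rewrite (sum_shift (G := fun k => (inI k)%:R *: cycder a (left_at I K k ^+ 2))
  (H := fun k => (inI k.+1)%:R *: cycder a (right_at I K k ^+ 2))).
- by rewrite subrr scaler0 addr0.
- by rewrite expr0n -insder1 insder0l scaler0.
- by move=> k; rewrite cycder_round_square.
rewrite (_ : inI _ = false) ?scale0r //; apply/existsP => -[j /andP[_ /eqP ji]].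
by have := ltn_ord j; move: ji => /=; lia.
Qed.

Lemma subst_elim_cycder_loop i : i \in I ->
  subst elim (cycder (full_loop i) (monomialized full full_kappa)) = 0.
Proof.
move=> iI; rewrite cycder_full_loop // (linearB (subst elim)) linearD /= subst_elim_left.
by rewrite subst_elim_right subst_elim_loop /loop_image iI subrr.
Qed.

(** In the chain rule for elim, an eliminated loop contributes nothing because its
    derivative becomes 0, and any other arrow is its own image, hence contributes
    only when it is the differentiated one. *)
Lemma subst_elim_cycder (c : arrow Q) :
  cycder c (monomialized I kappa') =
  subst elim (cycder (incl_arrow c : arrow Q0) (monomialized full full_kappa)).
Proof.
rewrite -cycder_elim -insder1 -[1](rmorph1 (subst elim)) insder_subst.
rewrite (bigD1 (incl_arrow c : arrow Q0)) // big1 ?addr0 => [|b /andP[_]].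
  rewrite elim_incl_arrow insder_arrow eqxx scale1r insder1.
  by rewrite -[in RHS]cycder_ends !rmorphM /= !subst_triv addr0; case: c => [[]|].
case: (full_arrowP b) => [i iI _|d].
  by rewrite insder1 subst_elim_cycder_loop // linear0.
rewrite (inj_eq incl_arrow_inj) elim_incl_arrow insder_arrow => /negPf ->.
exact: scale0r.
Qed.

Theorem jac_iso_full : jac_iso (monomialized full full_kappa) (monomialized I kappa').
Proof.
apply: (jac_iso_subst (F := elim) (G := incl)) => c.
- case: (full_arrowP c) => [i iI|d].
    by rewrite subst_elim_cycder_loop // rpred0.
  by rewrite -subst_elim_cycder jac_ideal_cycder.
- by exists (incl_arrow c); apply: subst_elim_cycder.
- by rewrite subst_arrow elim_incl_arrow.
case: (full_arrowP c) => [i iI|d].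
  rewrite /= /loop_image iI linearD /= subst_left_at // subst_right_at //.
  by rewrite -loop_at_full -cycder_full_loop // jac_ideal_cycder.
by rewrite elim_incl_arrow subst_arrow subrr rpred0.
Qed.

Lemma full_kappa_loop (i : 'I_n) : i \in I -> full_kappa (2 * i.+1 - 1)%N 2 != 0.
Proof.
move=> iI; rewrite /full_kappa mulnS add2n subn1 /= mul2n odd_double /=.
by rewrite uphalf_double /loop_kappa inIE iI oppr_eq0 invr_eq0.
Qed.
End LoopElimination.

Theorem proposition4p23 (R : realType) (n : nat) (hn : (1 <= n)%N)
    (I : {set 'I_n}) (kappa' : nat -> nat -> R[i]) :
  exists kappa : nat -> nat -> R[i],
    jac_iso (monomialized (@set0 'I_n) kappa) (monomialized I kappa') /\
    (forall i : 'I_n, i \in I -> kappa (2 * i.+1 - 1)%N 2%N != 0).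
Proof.
have two_neq0 : 2%:R != 0 :> R[i] by rewrite Num.Theory.pnatr_eq0.
by exists (full_kappa I kappa'); split;
   [exact: jac_iso_full | exact: full_kappa_loop].
Qed.
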